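(* If $G$ is a $2$-connected outerplanar graph with $\Delta(G)=\Delta\geq 4$ and girth $g(G)\geq 4$, then $\chi_{vi,1}(G)\leq \Delta+3$.
   Context: All graphs are finite, simple and undirected. An incidence of $G$ is a pair $(v,e)$ with $v\in V(G)$, $e\in E(G)$, $v\in e$; $I(G)$ is the set of incidences. Let $G^{1/3}$ be obtained from $G$ by replacing each edge $e=\{u,v\}$ by the path $u,(u,e),(v,e),v$. A $vi$-simultaneous proper $k$-coloring of $G$ is a map $c:V(G)\cup I(G)\to\{1,\dots,k\}$ such that any two distinct elements at distance at most $3$ in $G^{1/3}$ receive distinct colors. For a vertex $v$, $I_2(v)=\{(u,\{u,v\}) : u\in N_G(v)\}$. Such a coloring is a $(k,s)$-coloring if for every vertex $v$ at most $s$ distinct colors appear on $I_2(v)$; $\chi_{vi,s}(G)$ is the least such $k$. The girth is the length of a shortest cycle. A graph is outerplanar if it has a planar drawing with all vertices on the outer face. *)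

(* Defs.v *)
From HB Require Import structures.
From mathcomp Require Import all_boot all_order all_algebra.
From mathcomp Require Import all_classical all_reals all_analysis.

Set Implicit Arguments.
Unset Strict Implicit.
Unset Printing Implicit Defensive.

Import Order.TTheory GRing.Theory Num.Theory.
Import numFieldNormedType.Exports.

Record sgraph := SGraph {
  vertex :> finType;
  adj : rel vertex;
  adj_sym : symmetric adj;
  adj_irrefl : irreflexive adj }.

Definition neighbours (G : sgraph) (v : G) : {set G} := [set u | adj v u]%SET.

Definition max_degree (G : sgraph) : nat := \max_(v : G) #|neighbours v|.

Definition edges (G : sgraph) : {set {set G}} :=
  [set e | [exists x, exists y, adj x y && (e == [set x; y])]]%SET.

Definition joined_outside (G : sgraph) (X : {set G}) (x y : G) : bool :=
  connect [rel u v | [&& u \notin X, v \notin X & adj u v]] x y.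

Definition k_connected (k : nat) (G : sgraph) : Prop :=
  k < #|G| /\
  forall X : {set G}, #|X| < k ->
    forall x y : G, x \notin X -> y \notin X -> joined_outside X x y.

Definition is_least (P : nat -> Prop) (n : nat) : Prop :=
  P n /\ forall m, P m -> n <= m.

(* The cycles of the graph are the duplicate-free cyclic sequences of length
   at least 3: [ucycle] alone would also accept [::] and [:: x; y] with [x]
   adjacent to [y]. *)
Definition graph_cycle (G : sgraph) (c : seq G) : Prop :=
  2 < size c /\ ucycle (@adj G) c.

Definition is_girth (G : sgraph) : nat -> Prop :=
  is_least (fun n => exists2 c : seq G, graph_cycle c & size c = n).

Definition dist_le (G : sgraph) (n : nat) (x y : G) : Prop :=
  exists p : seq G, [/\ path (@adj G) x p, last x p = y & size p <= n].

Definition incidence (G : sgraph) : finType :=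
  {p : G * {set G} | (p.2 \in edges G) && (p.1 \in p.2)}.

Definition inc_vertex (G : sgraph) (i : incidence G) : G := (val i).1.
Definition inc_edge (G : sgraph) (i : incidence G) : {set G} := (val i).2.

(* The graph G^{1/3}: an edge e = {u, v} becomes the path u, (u,e), (v,e), v. *)
Definition third_adj (G : sgraph) (x y : G + incidence G) : bool :=
  match x, y with
  | inl _, inl _ => false
  | inl u, inr i => inc_vertex i == u
  | inr i, inl u => inc_vertex i == u
  | inr i, inr j => (inc_edge i == inc_edge j) && (inc_vertex i != inc_vertex j)
  end.

Lemma third_adj_sym (G : sgraph) : symmetric (@third_adj G).
Proof. by move=> [u|i] [v|j] //=; rewrite eq_sym (eq_sym (inc_vertex i)). Qed.

Lemma third_adj_irrefl (G : sgraph) : irreflexive (@third_adj G).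
Proof. by move=> [u|i] //=; rewrite !eqxx. Qed.

Definition third_subdivision (G : sgraph) : sgraph :=
  SGraph (@third_adj_sym G) (@third_adj_irrefl G).

Definition vi_proper (G : sgraph) (k : nat) (c : G + incidence G -> 'I_k) : Prop :=
  forall x y : third_subdivision G, x <> y -> dist_le 3 x y -> c x <> c y.

Definition I2 (G : sgraph) (v : G) : {set incidence G} :=
  [set i | [exists u in neighbours v, val i == (u, [set u; v])]]%SET.

Definition ks_coloring (G : sgraph) (k s : nat) (c : G + incidence G -> 'I_k) : Prop :=
  vi_proper c /\ forall v : G, #|[set c (inr i) | i in I2 v]%SET| <= s.

Definition is_chi_vi (G : sgraph) (s : nat) : nat -> Prop :=
  is_least (fun k => exists c : G + incidence G -> 'I_k, ks_coloring s c).

Local Open Scope classical_set_scope.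
Local Open Scope ring_scope.

(* A drawing in the plane R^2 without crossings. The value of [arc e] matters
   only on [0, 1] and only when [e] is an edge. *)
Record plane_drawing (R : realType) (G : sgraph) := PlaneDrawing {
  pos : G -> R * R;
  arc : {set G} -> R -> R * R;
  pos_inj : injective pos;
  arc_continuous : forall e, e \in edges G ->
    {within `[0, 1], continuous (arc e)};
  arc_inj : forall e, e \in edges G -> {in `[0, 1] &, injective (arc e)};
  arc_ends : forall e, e \in edges G ->
    [set arc e 0; arc e 1] = [set pos v | v in [set` e]];
  arc_avoids_vertices : forall (e : {set G}) (v : G) (t : R), e \in edges G ->
    t \in `]0, 1[ -> arc e t <> pos v;
  arcs_disjoint : forall (e f : {set G}) (s t : R),
    e \in edges G -> f \in edges G -> e <> f ->
    s \in `]0, 1[ -> t \in `]0, 1[ -> arc e s <> arc f t }.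

Definition drawing_set (R : realType) (G : sgraph) (d : plane_drawing R G) :
    set (R * R) :=
  range (pos d) `|` \bigcup_(e in [set` edges G]) (arc d e @` `[0, 1]).

Definition is_face (R : realType) (G : sgraph) (d : plane_drawing R G)
    (F : set (R * R)) : Prop :=
  exists2 p, (~` drawing_set d) p & F = connected_component (~` drawing_set d) p.

(* A vertex lies on a face when it is in the closure of the face. *)
Definition outerplanar (R : realType) (G : sgraph) : Prop :=
  exists d : plane_drawing R G, exists F : set (R * R),
    [/\ is_face d F, ~ bounded_set F & forall v : G, closure F (pos d v)].

(* Main.v *)
Require Import Defs.
From mathcomp Require Import all_boot all_order all_algebra.
From mathcomp Require Import all_classical all_reals all_analysis.
From mathcomp Require Import zify lra.

(** If all incidences in [I2 v] share a colour [d v], a (k,1)-colouring amounts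
    to a proper colouring [c] of G and a proper colouring [d] of its square with
    [c u] different from [d v] for all [v] in the closed neighbourhood of [u].

    Outerplanarity enters only through the absence of a K_{2,3} subdivision. Given
    this, a longest cycle is Hamiltonian, and, G being triangle-free, its chords
    do not cross. A chord [x y] spanning as few vertices as possible cuts off a
    path of at least two vertices of degree 2. Colour the rest by induction; then
    [d] extends greedily, the two ends of the path first (each sees at most
    Delta + 1, resp. Delta + 2, forbidden colours, because [x] and [y] are
    adjacent) and the other vertices afterwards, and finally [c].

    A K_{2,3} subdivision with branch vertex [a] is excluded by mod 2 winding
    numbers of fine chains of points. Cut the three arcs leaving [a] at their last
    visits e1, e2, e3 to a small square around [a], which splits the boundary of
    the square into three arcs. The cycle formed by the outer parts of routes j
    and k and the boundary arc avoiding e_l has the same winding number around [a]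
    as around the neighbour u_l, which is joined to [a] through e_l. Around u_l it
    winds as often as the full cycle formed by routes j and k, and the latter winds
    equally often around u_l and around any point of the face. Summing over the
    three pairs, the routes cancel on both sides, but the boundary of the square
    winds once around [a]. *)

Set Implicit Arguments.
Unset Strict Implicit.
Unset Printing Implicit Defensive.

(** * Greedy extension of colourings *)

Lemma leq_card_bigcup (I T : finType) (A : {set I}) (B : I -> {set T}) :
  #|\bigcup_(i in A) B i|%SET <= \sum_(i in A) #|B i|.
Proof.
elim/big_rec2: _ => [|i n C _ IH]; first by rewrite cards0.
by apply: leq_trans (leq_card_setU _ _) _; rewrite leq_add2l.
Qed.

Section Colouring.
Variables (G : sgraph) (k : nat).
Implicit Types (u v w x y : G) (S T M : {set G}) (f c d : G -> 'I_k).

Definition proper_on (r : rel G) S f :=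
  forall u v, u \in S -> v \in S -> r u v -> f u <> f v.

(** The count for [v] ranges over its [r]-neighbours in the final set, so it bounds the colours
    forbidden at [v] whenever its turn comes, and the order of [l] does not matter. Colours
    forbidden for other reasons go into [ext v]. *)
Lemma greedy_extension (r : rel G) (ext : G -> {set 'I_k}) S f (l : seq G) :
  symmetric r -> irreflexive r -> proper_on r S f ->
  {in l, forall v, v \notin S /\
     #|ext v| + #|[set w in S :|: [set w in l] | r v w]%SET| < k} ->
  exists f', [/\ {in S, f' =1 f}, proper_on r (S :|: [set w in l])%SET f' &
    {in l, forall v, f' v \notin ext v}].
Proof.
move=> rsym rirr; elim: l S f => [|v l IH] S f pf cnt.
  exists f; split=> //.
  by move=> u w; rewrite !inE !orbF => uS wS; exact: pf.
have [vS cv] := cnt v (mem_head _ _).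
have [a aP] : exists a, a \notin (ext v :|: [set f w | w in [set w in S | r v w]])%SET.
  apply/existsP; rewrite -negb_forall; apply/forallP => H.
  suff : (k <= #|ext v :|: [set f w | w in [set w in S | r v w]]|)%SET.
    rewrite leqNgt => /negP; apply.
    apply: leq_ltn_trans (leq_card_setU _ _) _; apply: leq_ltn_trans cv.
    rewrite leq_add2l; apply: leq_trans (leq_imset_card _ _) _.
    by apply/subset_leq_card/fintype.subsetP => w; rewrite !inE => /andP[-> ->].
  rewrite -{1}(card_ord k) -cardsT; apply/subset_leq_card/fintype.subsetP => b _; exact: H.
move: aP; rewrite inE negb_or => /andP[aext aS].
pose f1 w := if w == v then a else f w.
have f1S : {in S, f1 =1 f}.
  by move=> w wS; rewrite /f1; case: eqP => // E; rewrite -E wS in vS.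
(* A vertex that occurs again in [l] is left to its last occurrence. *)
have [vl|vl] := boolP (v \in l).
  have [|f' [e p q]] := IH S f pf.
    move=> w wl; have [|? ?] := cnt w _; first by rewrite inE wl orbT.
    split=> //; apply: leq_ltn_trans; last eassumption.
    rewrite leq_add2l; apply/subset_leq_card/fintype.subsetP => z; rewrite !inE.
    by case/andP=> /orP[->|->] ->; rewrite ?orbT.
  exists f'; split=> //.
    move=> u w; rewrite !inE => uS wS; apply: p; rewrite !inE.
      by case/or3P: uS => [->|/eqP ->|->]; rewrite ?vl ?orbT.
    by case/or3P: wS => [->|/eqP ->|->]; rewrite ?vl ?orbT.
  by move=> w; rewrite inE => /orP[/eqP ->|]; [exact: q | exact: q].
have [||f' [e p q]] := IH (v |: S)%SET f1.
- move=> u w; rewrite !inE => /orP[/eqP ->|uS] /orP[/eqP ->|wS]; rewrite ?rirr //.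
  + move=> vw; rewrite (f1S w) // /f1 eqxx => E; move/negP: aS; apply.
    by apply/imsetP; exists w => //; rewrite !inE wS.
  + rewrite rsym => vu; rewrite (f1S u) // /f1 eqxx => E; move/negP: aS; apply.
    by apply/imsetP; exists u => //; rewrite !inE uS.
  + by rewrite !f1S //; exact: pf.
- move=> w wl; have [|wS ?] := cnt w _; first by rewrite inE wl orbT.
  split; first by rewrite !inE negb_or wS andbT; apply: contraNneq vl => <-.
  apply: leq_ltn_trans; last eassumption.
  rewrite leq_add2l; apply/subset_leq_card/fintype.subsetP => z; rewrite !inE.
  by rewrite -orbA orbCA.
exists f'; split.
- by move=> w wS; rewrite e ?f1S // inE wS orbT.
- by move=> u w uS wS; apply: p; [move: uS | move: wS]; rewrite !inE -orbA orbCA.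
- move=> w; rewrite inE => /orP[/eqP ->|]; last exact: q.
  by rewrite e ?inE ?eqxx // /f1 eqxx.
Qed.

Definition nbhd S v : {set G} := [set w in S | adj v w]%SET.

(** On [S] this is adjacency in the square of the subgraph induced by [S]. *)
Definition near_in S : rel G :=
  fun u v => (u != v) && (adj u v || [exists w in S, adj u w && adj w v]).

Lemma near_in_sym S : symmetric (near_in S).
Proof.
move=> u v; rewrite /near_in eq_sym adj_sym; congr (_ && (_ || _)).
by apply: eq_existsb => w; rewrite (adj_sym u w) (adj_sym w v) (andbC (adj w u)).
Qed.

Lemma near_in_irrefl S : irreflexive (near_in S).
Proof. by move=> u; rewrite /near_in eqxx. Qed.

(* [d v] is the common colour of the incidences in [I2 v]. *)
Definition vi_pair S c d := [/\ {in S, forall u, c u <> d u},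
  proper_on (@adj G) S c, proper_on (near_in S) S d &
  forall u v, u \in S -> v \in S -> adj u v -> c u <> d v].

(** The edges [x v1] and [y v2] are the only ones between [S] and [M], so the old [c] restricts the
    new values of [d] only through [c x] at [v1] and [c y] at [v2]. All other mixed constraints are
    met at the end, when [c] is chosen on [M]. *)
Lemma vi_pair_extension (D : nat) S M x y v1 v2 c d :
  k = D + 3 -> 4 <= D -> (forall v, #|neighbours v| <= D) ->
  [disjoint S & M] -> x \in S -> y \in S -> adj x y ->
  v1 \in M -> v2 \in M -> v1 != v2 -> adj x v1 -> adj y v2 ->
  {in M, forall v, #|nbhd (S :|: M) v| <= 2} ->
  (forall v w, v \in M -> w \in S -> adj v w -> v = v1 /\ w = x \/ v = v2 /\ w = y) ->
  vi_pair S c d -> exists c' d', vi_pair (S :|: M) c' d'.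
Proof.
move=> kE D4 degD dSM xS yS xy v1M v2M n12 xv1 yv2 deg2 att [cd pc pd cdadj].
have k7 : 7 <= k by rewrite kE -[7]/(4 + 3) leq_add2r.
have MS v : v \in M -> v \notin S by move=> vM; rewrite (disjointFl dSM vM).
set T := (S :|: M)%SET in deg2 *.
pose r := near_in T.
have rsym : symmetric r := @near_in_sym T.
have rirr : irreflexive r := @near_in_irrefl T.
(* No two vertices of [S] become close through [M]: a vertex of [M] has at most one neighbour in
   [S]. *)
have pd0 : proper_on r S d.
  move=> u v uS vS /andP[uv H]; apply: pd => //; rewrite /near_in uv /=.
  case/orP: H => [->//|/existsP[w /and3P[]]]; rewrite !inE => /orP[wS|wM] uw wv.
    by apply/orP; right; apply/existsP; exists w; rewrite wS uw.
  have wu : adj w u by rewrite adj_sym.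
  by case: (att w u wM uS wu) => -[E1 E2]; case: (att w v wM vS wv) => -[E3 E4];
     move: uv n12; rewrite ?E2 ?E4 -?E1 -?E3 ?eqxx.
have degS z v : z \in S -> v \in M -> adj z v -> #|nbhd S z| < D.
  move=> zS vM zv; apply: leq_trans (degD z); apply: proper_card; apply/properP; split.
    by apply/fintype.subsetP => w; rewrite !inE => /andP[].
  by exists v; rewrite !inE ?zv // (negbTE (MS v vM)).
(* Forbidden at [v1] are [c x] and the values of [d] at [x] and at its neighbours in [S]. There are
   at most [D - 1] of these, since [v1] is a neighbour outside [S], and they include [y]. The total
   is at most [D + 1]. *)
have [|d1 [e1 p1 x1]] := @greedy_extension r (fun _ => [set c x]%SET)
  S d [:: v1] rsym rirr pd0.
  move=> v; rewrite inE => /eqP ->; split; first exact: MS.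
  rewrite cards1.
  have : [set w in S :|: [set w in [:: v1]] | r v1 w]%SET \subset (x |: nbhd S x)%SET.
    apply/fintype.subsetP => w; rewrite !inE => /andP[/orP[wS|/eqP ->]]; last by rewrite rirr.
    move=> /andP[_ /orP[v1w|/existsP[z /and3P[]]]].
      by case: (att v1 w v1M wS v1w) => -[E1 ->]; rewrite ?eqxx ?yS ?xy ?orbT.
    rewrite !inE => /orP[zS|zM] v1z zw.
      case: (att v1 z v1M zS v1z) => -[E1 E2]; first by rewrite wS -E2 zw orbT.
      by rewrite E1 eqxx in n12.
    by case: (att z w zM wS zw) => -[E1 ->]; rewrite ?eqxx ?yS ?xy ?orbT.
  move=> /subset_leq_card/leq_trans/(_ (leq_card_setU _ _)); rewrite cards1.
  by have := degS x v1 xS v1M xv1; rewrite [in X in _ -> _ -> X]kE; clear; lia.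
(* The same count at [v2], increased by one for [v1], gives at most [D + 2] forbidden colours, one
   fewer than [k]. *)
have [|d2 [e2 p2 x2]] := @greedy_extension r (fun _ => [set c y]%SET)
  _ d1 [:: v2] rsym rirr p1.
  move=> v; rewrite inE => /eqP ->; split.
    by rewrite !inE negb_or MS //= eq_sym.
  rewrite cards1.
  have : [set w in (S :|: [set w in [:: v1]]) :|: [set w in [:: v2]] | r v2 w]%SET
      \subset (v1 |: (y |: nbhd S y))%SET.
    apply/fintype.subsetP => w; rewrite !inE.
    move=> /andP[/orP[/orP[wS|/eqP ->]|/eqP ->]]; rewrite ?eqxx ?rirr //.
    move=> /andP[_ /orP[v2w|/existsP[z /and3P[]]]].
      by case: (att v2 w v2M wS v2w) => -[E1 ->]; rewrite ?eqxx ?xS 1?adj_sym ?xy ?orbT.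
    rewrite !inE => /orP[zS|zM] v2z zw.
      case: (att v2 z v2M zS v2z) => -[E1 E2]; last by rewrite wS -E2 zw !orbT.
      by rewrite E1 eqxx in n12.
    by case: (att z w zM wS zw) => -[E1 ->]; rewrite ?eqxx ?xS ?(adj_sym y) ?xy ?orbT.
  move=> /subset_leq_card/leq_trans/(_ (leq_card_setU _ _)); rewrite cards1.
  have := (leq_card_setU [set y]%SET (nbhd S y)).1; rewrite cards1.
  by have := degS y v2 yS v2M yv2; rewrite [in X in _ -> _ -> _ -> X]kE; clear; lia.
pose S2 := (S :|: [set w in [:: v1]] :|: [set w in [:: v2]])%SET.
have TE : (S2 :|: [set w in enum (M :\: S2)] = T)%SET.
  apply/setP => w; rewrite !inE mem_enum !inE.
  have [->|] := eqVneq w v1; first by rewrite v1M !orbT.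
  have [->|] := eqVneq w v2; first by rewrite v2M !orbT.
  by rewrite !orbF; case: (w \in S).
(* The neighbours of a remaining vertex all lie in [M] and have no value of [c] yet. At most two
   vertices are at distance one and at most two at distance two, so four colours are forbidden at
   most. *)
have [|d3 [e3 p3 x3]] := @greedy_extension r (fun _ => finset.set0)
  S2 d2 (enum (M :\: S2)%SET) rsym rirr p2.
  move=> v; rewrite mem_enum inE => /andP[vS2 vM]; split=> //.
  rewrite cards0 add0n TE.
  have nM w : w \in nbhd T v -> w \in M.
    rewrite !inE => /andP[/orP[wS|//] vw].
    by case: (att v w vM wS vw) => -[E1 _]; move: vS2; rewrite !inE E1 eqxx !orbT.
  have : [set w in T | r v w]%SET \subset
      (nbhd T v :|: \bigcup_(w in nbhd T v) (nbhd T w :\ v))%SET.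
    apply/fintype.subsetP => w; rewrite !inE.
    move=> /andP[wT /andP[vw /orP[->|/existsP[z /and3P[zT vz zw]]]]].
      by rewrite wT.
    apply/orP; right; apply/bigcupP; exists z; rewrite ?inE.
      by move: zT; rewrite /T inE vz => ->.
    by rewrite eq_sym vw zw andbT; move: wT; rewrite /T ?inE => ->.
  move=> /subset_leq_card/leq_trans/(_ (leq_card_setU _ _)).
  have : #|\bigcup_(w in nbhd T v) (nbhd T w :\ v)|%SET <= 2.
    apply: leq_trans (leq_card_bigcup _ _) _.
    apply: (@leq_trans (\sum_(w in nbhd T v) 1)); last by rewrite sum1_card deg2.
    apply: leq_sum => w wv; have := deg2 w (nM w wv); rewrite (cardsD1 v).
    have -> : v \in nbhd T w; last by rewrite add1n ltnS.
    by move: wv; rewrite !inE vM orbT (adj_sym v) => /andP[].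
  move=> h1 h2; apply: leq_ltn_trans h2 _.
  by apply: leq_ltn_trans (leq_add (deg2 v vM) h1) _; exact: leq_trans k7.
rewrite TE in p3.
have d3S : {in S, d3 =1 d}.
  move=> w wS; rewrite e3 ?e2 ?e1 // !inE wS //.
have d3v1 : d3 v1 != c x.
  rewrite e3 ?e2 ?inE ?eqxx ?orbT //.
  by have := x1 v1 (mem_head _ _); rewrite !inE.
have d3v2 : d3 v2 != c y.
  rewrite e3 ?inE ?eqxx ?orbT //.
  by have := x2 v2 (mem_head _ _); rewrite !inE.
have adj_irr : irreflexive (@adj G) := @adj_irrefl G.
have SME : (S :|: [set w in enum M] = T)%SET by apply/setP => w; rewrite !inE mem_enum.
(* At most three values of [d], at [v] and its neighbours, and two of [c] are forbidden. *)
have [|c' [e4 p4 x4]] := @greedy_extension (@adj G)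
  (fun v => [set d3 w | w in v |: nbhd T v]%SET) S c (enum M) (@adj_sym G) adj_irr pc.
  move=> v; rewrite mem_enum => vM; split; first exact: MS.
  rewrite SME -/(nbhd T v).
  have h1 : #|[set d3 w | w in v |: nbhd T v]%SET| <= 3.
    apply: leq_trans (leq_imset_card _ _) _; rewrite cardsU1.
    by apply: (@leq_add _ _ 1 2); [case: (_ \notin _) | exact: deg2].
  apply: leq_ltn_trans (leq_add h1 (deg2 v vM)) _.
  exact: leq_trans k7.
rewrite SME in p4.
have x4' v : v \in M -> c' v \notin [set d3 w | w in v |: nbhd T v]%SET.
  by move=> vM; apply: x4; rewrite mem_enum.
exists c', d3; split=> //.
- move=> u; rewrite inE => /orP[uS|uM]; first by rewrite e4 // d3S //; exact: cd.
  move=> E; have /imsetP := x4' u uM; case; exists u => //.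
  by rewrite !inE eqxx.
- move=> u v; rewrite inE => /orP[uS|uM] vT uv; last first.
    move=> E; have /imsetP := x4' u uM; case; exists v => //.
    by rewrite !inE uv andbT; move: vT; rewrite inE => ->; rewrite orbT.
  rewrite e4 //; move: vT; rewrite inE => /orP[vS|vM].
    by rewrite d3S //; exact: cdadj.
  by rewrite adj_sym in uv; case: (att v u vM uS uv) => -[-> ->]; apply/eqP; rewrite eq_sym.
Qed.
End Colouring.

(** * Cycles with non-crossing chords *)

Lemma subseq_consP (T : eqType) (x : T) (t s : seq T) : subseq (x :: t) s ->
  exists l1 l2, s = l1 ++ x :: l2 /\ subseq t l2.
Proof.
elim: s => //= y s IH; case: eqP => [<- ts|_ /IH[l1 [l2 [-> ts]]]].
  by exists [::], s.
by exists (y :: l1), l2.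
Qed.

Section Outer.
Variable G : sgraph.
Implicit Types (a b u v w x y z : G) (s m p q l : seq G).

Definition triangle_free := forall a b u, adj a b -> adj b u -> adj a u -> False.

Definition noncrossing s := forall a b u v, subseq [:: a; b; u; v] s ->
  adj a u -> adj b v -> False.

(** The four values taken by [c] and [d] are distinct, which meets all conditions at once. *)
Lemma vi_pair_edge k x y : 4 <= k -> x != y ->
  exists c d : G -> 'I_k, vi_pair [set v in [:: x; y]]%SET c d.
Proof.
move=> k4 xy.
pose o (i : 'I_4) : 'I_k := widen_ord k4 i.
have oinj i j : o i = o j -> i = j by move=> /(congr1 val) /= ?; apply: val_inj.
exists (fun v => if v == x then o (@inord 3 0) else o (@inord 3 1)).
exists (fun v => if v == x then o (@inord 3 2) else o (@inord 3 3)).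
have E i j : i < 4 -> j < 4 -> o (@inord 3 i) = o (@inord 3 j) -> i = j.
  by move=> i4 j4 /oinj/(congr1 val) /=; rewrite !inordK.
have yx : (y == x) = false by rewrite eq_sym; exact: negbTE.
have in2 u v : u \in [set v in [:: x; y]]%SET -> v \in [set v in [:: x; y]]%SET ->
    u != v -> (u == x) = (v != x).
  by rewrite !inE => /orP[] /eqP -> /orP[] /eqP ->; rewrite ?eqxx ?yx.
have adjN u v : adj u v -> u != v by apply: contraTneq => ->; rewrite adj_irrefl.
split.
- by move=> u _; case: (u == x) => /E; lia.
- by move=> u v uS vS /adjN/(in2 _ _ uS vS) ->; case: (v == x) => /E; lia.
- by move=> u v uS vS /andP[/(in2 _ _ uS vS) -> _]; case: (v == x) => /E; lia.
- by move=> u v uS vS /adjN/(in2 _ _ uS vS) ->; case: (v == x) => /E; lia.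
Qed.

(** Induction on the length of the cycle, opened at one of its edges. Removing the vertices spanned
    by a shortest chord leaves a shorter cycle, or a single edge, to which the same hypotheses
    apply. *)
Lemma outer_cycle_colouring (D k : nat) s x0 : k = D + 3 -> 4 <= D ->
  (forall v, #|neighbours v| <= D) -> triangle_free ->
  uniq s -> 1 < size s -> sorted (@adj G) s -> adj (head x0 s) (last x0 s) ->
  noncrossing s -> exists c d : G -> 'I_k, vi_pair [set v in s]%SET c d.
Proof.
move=> kE D4 degD tri; have [n] := ubnP (size s); elim: n s => // n IH s.
rewrite ltnS => sn us s1 ss hl nc.
have [s2|s3] := leqP (size s) 2.
  case: s us s1 s2 {sn ss hl nc} => [|x [|y []]] //=; rewrite inE andbT => xy _ _.
  by apply: vi_pair_edge => //; lia.
(* Requiring [i.+1] vertices in between excludes the edges of the path [s] itself. The edge closing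
   the cycle qualifies, so a minimum exists. *)
pose P i := `[< exists l1 x m y l2,
  [/\ s = l1 ++ x :: m ++ y :: l2, adj x y & size m = i.+1] >].
have exP : exists i, P i.
  case: s s3 hl us {sn s1 ss nc} @P => // x s.
  case/lastP: s => // m y; rewrite /= last_rcons size_rcons => s3 xy _.
  exists (size m).-1; apply/asboolP; exists [::], x, m, y, [::].
  by split=> //=; [rewrite cats1 | lia].
case: (ex_minnP exP) => i /asboolP[l1 [x [m [y [l2 [sE xy mi]]]]]] imin.
have minm l1' x' m' y' l2' : s = l1' ++ x' :: m' ++ y' :: l2' -> adj x' y' ->
    size m' < size m -> m' = [::].
  move=> sE' xy' sm; case: m' sE' sm => // z m' sE' /=.
  suff : i <= size m' by lia.
  by apply: imin; apply/asboolP; exists l1', x', (z :: m'), y', l2'.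
(* Vertices of [m] have degree 2 in the cycle with its chords: an edge to another vertex of
   [x :: rcons m y] would span fewer vertices than [x y], and an edge to [l1] or [l2] would cross
   [x y]. *)
have nb v m1 m2 w : m = m1 ++ v :: m2 -> w \in s -> adj v w ->
    w = last x m1 \/ w = head y m2.
  move=> mE; rewrite sE mem_cat inE mem_cat inE mE mem_cat inE -!orbA.
  have before : w \in x :: m1 -> adj v w -> w = last x m1.
    move=> wx vw; case/splitPr E: {1}(x :: m1) / wx => [p1 p2].
    have p20 : p2 = [::].
      apply: (@minm (l1 ++ p1) w p2 v (m2 ++ y :: l2)).
      - by rewrite sE mE -!catA /= -cat_cons E -!catA.
      - by rewrite adj_sym.
      - have : size (x :: m1) = size (p1 ++ w :: p2) by rewrite E.
        by rewrite mE !size_cat /=; lia.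
    by rewrite -[last x m1]/(last x (x :: m1)) E p20 last_cat.
  have after : w \in rcons m2 y -> adj v w -> w = head y m2.
    move=> wx vw; case/splitPr E: {1}(rcons m2 y) / wx => [p1 p2].
    have p10 : p1 = [::].
      apply: (@minm (l1 ++ x :: m1) v p1 w (p2 ++ l2)) => //.
      - by rewrite sE mE -!catA /= -(cat_rcons y m2) E -!catA.
      - have : size (rcons m2 y) = size (p1 ++ w :: p2) by rewrite E.
        by rewrite mE size_rcons !size_cat /=; lia.
    by move: E; rewrite p10; case: (m2) => [|? ?] /= [].
  have wbefore : (w == x) || (w \in m1) -> w \in x :: m1 by rewrite inE.
  have wafter : (w \in m2) || (w == y) -> w \in rcons m2 y by rewrite mem_rcons inE orbC.
  have sub1 z : subseq [:: z] [:: z] by rewrite /= eqxx.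
  case/orP => [wl1|/orP[wx|/orP[wm1|/orP[/eqP ->|/orP[wm2|/orP[wy|wl2]]]]]] vw.
  - exfalso; apply: (nc w x v y) _ _ xy; last by rewrite adj_sym.
    rewrite sE mE -[_ :: _]/([:: w] ++ [:: x] ++ [:: v] ++ [:: y]).
    apply: cat_subseq; first by rewrite sub1seq.
    rewrite /= eqxx -[[:: v; y]]/([:: v] ++ [:: y]).
    by apply: cat_subseq; rewrite sub1seq ?mem_cat !inE eqxx ?orbT.
  - by left; apply: before => //; apply: wbefore; rewrite wx.
  - by left; apply: before => //; apply: wbefore; rewrite wm1 orbT.
  - by rewrite adj_irrefl in vw.
  - by right; apply: after => //; apply: wafter; rewrite wm2.
  - by right; apply: after => //; apply: wafter; rewrite wy orbT.
  - exfalso; apply: (nc x v y w) _ xy vw.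
    rewrite sE mE -[[:: x; v; y; w]]/([::] ++ [:: x; v; y; w]).
    apply: cat_subseq; first exact: sub0seq.
    rewrite /= eqxx -[[:: v; y; w]]/([:: v] ++ [:: y; w]).
    apply: cat_subseq; first by rewrite sub1seq mem_cat inE eqxx orbT.
    by rewrite /= eqxx sub1seq.
have [xnm [ynm ynx]] : x \notin m /\ y \notin m /\ y != x.
  move: us; rewrite sE cat_uniq => /and3P[_ _ /=]; rewrite mem_cat inE !negb_or.
  move=> /andP[/and3P[-> xy' _]]; rewrite cat_uniq => /and3P[_ + _].
  by rewrite /= negb_or => /andP[-> _]; rewrite eq_sym.
pose s' := l1 ++ x :: y :: l2.
have mP z : z \in m -> z \notin s'.
  move=> zm; apply/negP => zs'; have := count_uniq_mem z us.
  rewrite sE count_cat /= count_cat /= => H.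
  have := zs'; rewrite -has_pred1 has_count count_cat /=.
  have := zm; rewrite -has_pred1 has_count.
  by move: H; case: (z \in _) => /=; clear; lia.
have spath : path (@adj G) x (rcons m y).
  move: ss; rewrite sE -(cat_rcons y m) -cat_cons.
  case: (l1) => [|z l]; rewrite /= cat_path => /andP[] //.
  by rewrite /= cat_path => _ /and3P[].
(* A single vertex in [m] would form a triangle with [x] and [y]. *)
have m2 : 1 < size m.
  case: (m) mi spath => [|v [|? ?]] //= _ /and3P[xv vy _].
  by case: (tri x v y).
have um : uniq m.
  by move: us; rewrite sE cat_uniq /= cat_uniq => /and5P[_ _ _ ? _].
have [v1 [m' [mE m'N]]] : exists v1 m', m = v1 :: m' /\ 0 < size m'.
  by case: (m) m2 => // v m' ?; exists v, m'.
pose v2 := last v1 m'.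
have v2m' : v2 \in m' by rewrite /v2; case: (m') m'N => //= z l _; exact: mem_last.
have v1m : v1 \in m by rewrite mE mem_head.
have v2m : v2 \in m by rewrite mE inE v2m' orbT.
have n12 : v1 != v2 by apply: contraTneq v2m' => <-; move: um; rewrite mE => /andP[].
have xv1 : adj x v1 by move: spath; rewrite mE => /andP[].
have yv2 : adj y v2 by rewrite adj_sym; move: spath; rewrite rcons_path mE => /andP[].
have sE' : [set v in s]%SET = ([set v in s'] :|: [set v in m])%SET.
  apply/setP => z; rewrite !inE sE /s' !(mem_cat, inE) /=.
  by do !case: (_ == _); do !case: (_ \in _).
have ss's : subseq s' s.
  rewrite /s' sE; apply: cat_subseq => //; rewrite /= eqxx.
  exact: suffix_subseq.
have [c [d cd]] : exists c d : G -> 'I_k, vi_pair [set v in s']%SET c d.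
  apply: IH.
  - move: sn m2; rewrite sE /s' !size_cat /= size_cat /=; clear; lia.
  - exact: subseq_uniq us.
  - by rewrite /s' size_cat /= !addnS.
  - move: ss; rewrite sE /s'; case: (l1) => [|z l] /=.
      by rewrite cat_path /= xy => /and3P[].
    by rewrite !cat_path /= cat_path /= xy => /and5P[-> -> _ _ ->].
  - by move: hl; rewrite sE /s' !last_cat /= last_cat; case: (l1).
  - by move=> a b u v /subseq_trans/(_ ss's); exact: nc.
rewrite sE'; apply: (@vi_pair_extension G k D _ _ x y v1 v2 c d) => //.
- rewrite disjoint_sym disjoint_subset; apply/fintype.subsetP => z; rewrite !inE; exact: mP.
- by rewrite inE mem_cat inE eqxx orbT.
- by rewrite inE mem_cat !inE eqxx !orbT.
- by rewrite inE.
- by rewrite inE.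
- move=> v; rewrite inE -sE' => vm; case/splitPr E: {1}m / vm => [p1 p2].
  apply: (@leq_trans #|[set last x p1; head y p2]%SET|); last by rewrite cards2; case: (_ != _).
  apply/subset_leq_card/fintype.subsetP => w; rewrite !inE => /andP[ws vw].
  by case: (nb _ _ _ _ E ws vw) => ->; rewrite eqxx ?orbT.
- move=> v w; rewrite inE => vm; rewrite inE => ws' vw.
  have ws : w \in s by exact: mem_subseq ss's _ ws'.
  have wm : w \notin m by apply: contraL ws'; exact: mP.
  case/splitPr E: {1}m / vm => [p1 p2].
  case: (nb _ _ _ _ E ws vw) => wE; [left | right].
    case: p1 E wE => [|z p1] E wE; first by move: E; rewrite mE => -[].
    by move: wm; rewrite E wE mem_cat -[last x _]/(last z p1) mem_last.
  case: p2 E wE => [|z p2] E wE.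
    by split=> //; move: (congr1 (last x) E); rewrite mE last_cat.
  by move: wm; rewrite E wE mem_cat !inE eqxx !orbT.
Qed.
End Outer.

(** * Hamiltonian cycles and crossing chords in graphs without theta subdivisions *)

Section Hamilton.
Variable G : sgraph.
Implicit Types (a b u v w x y z : G) (s m p q l : seq G).

Lemma joined_path (X : {set G}) x p : path (@adj G) x p ->
  {in x :: p, forall z, z \notin X} -> joined_outside X x (last x p).
Proof.
move=> xp XN; apply/connectP; exists p => //.
elim: p x xp XN => //= y p IH x /andP[xy yp] XN.
rewrite xy !XN ?inE ?eqxx ?orbT //=; apply: IH => // z zp.
by apply: XN; rewrite inE zp orbT.
Qed.

Lemma joined_sym (X : {set G}) x y : joined_outside X x y -> joined_outside X y x.
Proof.
rewrite /joined_outside sym_connect_sym // => u v.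
by rewrite /= adj_sym andbCA.
Qed.

(* The routes from the [u_i] to [b] need not be disjoint; if they are, this says
   that there is no K_{2,3} subdivision with branch vertices [a] and [b]. *)
Definition theta_free := forall a b u1 u2 u3, adj a u1 -> adj a u2 -> adj a u3 ->
  uniq [:: u1; u2; u3] -> joined_outside [set a; u2; u3]%SET u1 b ->
  joined_outside [set a; u1; u3]%SET u2 b -> joined_outside [set a; u1; u2]%SET u3 b ->
  False.

Lemma mem_count (z : G) s : z \in s -> 0 < count_mem z s.
Proof. by rewrite -has_pred1 has_count. Qed.

Lemma uniq_count (z : G) s : uniq s -> count_mem z s <= 1.
Proof. by move=> us; rewrite count_uniq_mem // leq_b1. Qed.

(** The neighbours of [a] to be used are its successor [x], the other end [u] of its chord, and its
    predecessor [w]. From [x] the cycle is followed forwards to [b], from [u] backwards to [b], and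
    from [w] backwards to [v], whence the chord [b v] leads to [b]. The vertex [x] between [a] and
    [b] keeps [b] out of the deleted sets. *)
Lemma crossing_theta a b u v x p1 p2 p3 p4 : theta_free ->
  ucycle (@adj G) (a :: (x :: p1) ++ b :: p2 ++ u :: p3 ++ v :: p4) ->
  adj a u -> adj b v -> False.
Proof.
move=> tf /andP[cyc us] au bv.
(* Stated as a sum, the absence of repetitions on the cycle turns every disjointness check below
   into linear arithmetic. *)
have cnt z : (a == z) + ((x == z) + (count_mem z p1 + ((b == z) + (count_mem z p2 +
    ((u == z) + (count_mem z p3 + ((v == z) + count_mem z p4))))))) <= 1.
  by have := uniq_count z us; rewrite /= !count_cat /= !count_cat /= !count_cat.
move: cyc; do 3!rewrite /= rcons_cat; rewrite /= cat_path /= => /and4P[ax xp1 p1b].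
rewrite cat_path /= => /and3P[bp2 p2u]; rewrite cat_path /= => /and3P[_ _].
rewrite rcons_path => /andP[vp4 p4a] {us}.
have [w wE] : exists w, w = last v p4 by exists (last v p4).
have w0 : 0 < (v == w) + count_mem w p4 by have := mem_count (mem_last v p4); rewrite -wE.
have Xnot (X : {set G}) q : {in X, forall z, count_mem z q = 0} -> {in q, forall z, z \notin X}.
  move=> Xq z zq; apply/negP => /Xq; have := mem_count zq; lia.
have cons_count z y q : count_mem z (y :: q) = (y == z) + count_mem z q by [].
have rcons_count z y q : count_mem z (rcons q y) = count_mem z q + (y == z).
  by rewrite -cats1 count_cat /= addn0.
apply: (tf a b x u w) => //.
- by rewrite wE adj_sym.
- rewrite /= !inE negb_or andbT -andbA; apply/and3P; split; apply/eqP => E.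
  + by move: (cnt x); rewrite -E !eqxx; clear; lia.
  + by move: (cnt x) w0; rewrite -E !eqxx; clear; lia.
  + by move: (cnt u) w0; rewrite -E !eqxx; clear; lia.
- have -> : b = last x (rcons p1 b) by rewrite last_rcons.
  apply: joined_path; first by rewrite rcons_path xp1.
  apply: Xnot => z; rewrite !inE cons_count rcons_count.
  case/orP=> [/orP[]|] /eqP ->.
  + by move: (cnt a); rewrite eqxx; clear; lia.
  + by move: (cnt u); rewrite eqxx; clear; lia.
  + by move: (cnt w) w0; clear; lia.
- apply: joined_sym; have -> : u = last b (rcons p2 u) by rewrite last_rcons.
  apply: joined_path; first by rewrite rcons_path bp2.
  apply: Xnot => z; rewrite !inE cons_count rcons_count.
  case/orP=> [/orP[]|] /eqP ->.
  + by move: (cnt a); rewrite eqxx; clear; lia.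
  + by move: (cnt x); rewrite eqxx; clear; lia.
  + by move: (cnt w) w0; clear; lia.
- apply: joined_sym; rewrite wE -[last v p4]/(last b (v :: p4)).
  apply: joined_path; first by rewrite /= bv.
  apply: Xnot => z; rewrite !inE !cons_count.
  case/orP=> [/orP[]|] /eqP ->.
  + by move: (cnt a); rewrite eqxx; clear; lia.
  + by move: (cnt x); rewrite eqxx; clear; lia.
  + by move: (cnt u); rewrite eqxx; clear; lia.
Qed.

(** If a vertex lies between [a] and [b], these serve as branch vertices. Otherwise, if one lies
    between [b] and [u], the cycle is rotated to start at [b] and the chords exchange roles. If
    neither holds, [a], [b], [u] form a triangle. *)
Lemma noncrossing_cycle s : theta_free -> triangle_free G -> ucycle (@adj G) s -> noncrossing s.
Proof.
move=> tf tri us a b u v.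
move=> /subseq_consP[l0 [l1 [sE]]] /subseq_consP[p1 [l2 [l1E]]].
move=> /subseq_consP[p2 [l3 [l2E]]] /subseq_consP[p3 [p4' [l3E _]]] au bv.
pose p4 := p4' ++ l0.
have {us} us : ucycle (@adj G) (a :: p1 ++ b :: p2 ++ u :: p3 ++ v :: p4).
  have <- : rot (size l0) s = a :: p1 ++ b :: p2 ++ u :: p3 ++ v :: p4.
    by rewrite sE rot_size_cat l1E l2E l3E /p4 /= -!catA /= -!catA /= -!catA.
  by rewrite /ucycle rot_cycle rot_uniq.
have us2 : ucycle (@adj G) (b :: p2 ++ u :: p3 ++ v :: p4 ++ a :: p1).
  have <- : rot (size (a :: p1)) ((a :: p1) ++ (b :: p2 ++ u :: p3 ++ v :: p4)) =
    b :: p2 ++ u :: p3 ++ v :: p4 ++ a :: p1.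
    by rewrite rot_size_cat /= -catA /= -catA.
  by rewrite /ucycle rot_cycle rot_uniq.
case: p1 us us2 {l1E} => [|x p1] us us2; last exact: crossing_theta us au bv.
case: p2 us us2 {l2E} => [|x p2] us us2; last first.
  by apply: crossing_theta us2 bv _ => //; rewrite adj_sym.
by move: us => /andP[/= /and3P[ab bu _] _]; apply: (tri a b u).
Qed.

Lemma path_enters (A : {set G}) x p : path (@adj G) x p -> x \notin A -> last x p \in A ->
  exists p1 b p2, [/\ p = p1 ++ b :: p2, b \in A & {in x :: p1, forall z, z \notin A}].
Proof.
elim: p x => [|y p IH] x /=; first by move=> _ /negbTE ->.
move=> /andP[xy yp] xA lA; have [yA|yA] := boolP (y \in A).
  by exists [::], y, p; split=> // z; rewrite inE => /eqP ->.
have [p1 [b [p2 [-> bA h]]]] := IH y yp yA lA.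
exists (y :: p1), b, p2; split=> // z; rewrite inE => /orP[/eqP -> //|].
exact: h.
Qed.

Lemma ucycle_rev a s : ucycle (@adj G) (a :: s) -> ucycle (@adj G) (a :: rev s).
Proof.
rewrite /ucycle => /andP[cyc us]; rewrite -(rot_cycle 1) -(rot_uniq 1) rot1_cons -rev_cons.
rewrite rev_uniq us andbT rev_cycle.
by rewrite (eq_cycle (e' := @adj G)) // => x y; rewrite adj_sym.
Qed.

Lemma joined_outside_path (X : {set G}) x y : joined_outside X x y -> x \notin X ->
  exists p, [/\ path (@adj G) x p, last x p = y, uniq (x :: p) &
    {in x :: p, forall z, z \notin X}].
Proof.
move=> /connectP[p0 pp yE] xX.
case/shortenP: pp yE => p pp up _ ->; exists p; split=> //.
- by apply: sub_path pp => u v /= /and3P[].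
- elim: p x xX pp {up} => [|z p IH] x xX /=; first by move=> _ z; rewrite inE => /eqP ->.
  move=> /andP[/and3P[_ zX _] /IH] /(_ zX) h u; rewrite inE => /orP[/eqP -> //|].
  exact: h.
Qed.

(** A longest cycle missing a vertex has an ear [w :: m] from [a] to another vertex [b] of the
    cycle. If [a] and [b] are consecutive, the ear can be inserted to lengthen the cycle. Otherwise
    [w] and the two neighbours of [a] on the cycle start three routes to [b]. *)
Lemma hamiltonian_cycle : k_connected 2 G -> theta_free ->
  (exists s : seq G, graph_cycle s) -> exists2 s : seq G, graph_cycle s & forall v, v \in s.
Proof.
move=> [_ conn] tf [s0 gs0].
pose P i := `[< exists2 s : seq G, graph_cycle s & size s = i >].
have exP : exists i, P i by exists (size s0); apply/asboolP; exists s0.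
have ubP i : P i -> i <= #|G|.
  by move=> /asboolP[s [_ /andP[_ us]] <-]; rewrite -(card_uniqP us) max_card.
case: (ex_maxnP exP ubP) => n /asboolP[s gs sn] nmax; exists s => // w0.
apply/negPn/negP => w0s; have [s2 us] := gs.
have [x xs] : exists x, x \in s by case: (s) s2 => // x ? _; exists x; exact: mem_head.
have emp z : z \notin (finset.set0 : {set G}) by rewrite inE.
have c0 : #|(finset.set0 : {set G})| < 2 by rewrite cards0.
have [p0 [pp0 lp0 _ _]] := joined_outside_path (conn _ c0 _ _ (emp w0) (emp x)) (emp w0).
pose A := [set v in s]%SET.
have AE z : (z \in A) = (z \in s) by rewrite inE.
have [p1 [a [p2 [p0E]]]] : exists p1 a p2, [/\ p0 = p1 ++ a :: p2, a \in A &
    {in w0 :: p1, forall z, z \notin A}].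
  by apply: path_enters => //; rewrite AE ?lp0.
rewrite AE => as_ /(_ _ (mem_last w0 p1)).
set w := last w0 p1; rewrite AE => ws.
have aw : adj a w by move: pp0; rewrite p0E cat_path /= adj_sym => /and3P[].
have [i c' rotE] := rot_to as_.
have sE z : (z \in s) = (z \in a :: c') by rewrite -rotE mem_rot.
have sz : size s = (size c').+1 by rewrite -(size_rot i) rotE.
have {}us : ucycle (@adj G) (a :: c') by rewrite -rotE /ucycle rot_cycle rot_uniq.
have [z [zs za]] : exists z, z \in s /\ z != a.
  case: c' rotE sE sz us => [|z c'] _ sE sz; first by rewrite sz in s2.
  move=> /andP[_ /= /andP[]]; rewrite inE negb_or => /andP[az _] _.
  by exists z; rewrite sE !inE eqxx orbT eq_sym.
have c1 : #|[set a]%SET| < 2 by rewrite cards1.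
have wa : w \notin [set a]%SET by rewrite inE; apply: contraNneq ws => ->.
have za' : z \notin [set a]%SET by rewrite inE.
have [p [pp lp up pa]] := joined_outside_path (conn _ c1 _ _ wa za') wa.
have [m [b [p3 [pE]]]] : exists m b p3, [/\ p = m ++ b :: p3, b \in A &
    {in w :: m, forall z, z \notin A}].
  by apply: path_enters => //; rewrite AE ?lp.
rewrite AE => bs mA.
have ms v : v \in w :: m -> v \notin s by move=> /mA; rewrite AE.
have ba : b != a by have := pa b; rewrite pE !inE mem_cat inE eqxx !orbT => /(_ isT).
have bc' : b \in c' by move: bs; rewrite sE inE (negbTE ba).
have [wm mb] : path (@adj G) w m /\ adj (last w m) b.
  by move: pp; rewrite pE cat_path /= => /and3P[].
have um : uniq (w :: m) by move: up; rewrite pE -cat_cons cat_uniq => /and3P[].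
have shortcut c2 : ucycle (@adj G) (a :: b :: c2) -> {subset a :: b :: c2 <= s} ->
    size (b :: c2) = size c' -> False.
  move=> /andP[cyc uc] sub szc.
  have : graph_cycle (a :: (w :: m) ++ b :: c2).
    split; first by rewrite /= size_cat /= !addnS.
    apply/andP; split.
      rewrite /= rcons_cat /= aw cat_path /= wm mb.
      by move: cyc => /= /andP[].
    move: uc; rewrite [uniq (a :: b :: c2)]cons_uniq => /andP[ac uc].
    rewrite cons_uniq mem_cat negb_or ac andbT cat_uniq um uc andbT.
    apply/andP; split; first by apply: contraL as_; exact: ms.
    apply/hasPn => v vc; apply/negP => /ms; rewrite sub //.
    by rewrite inE vc orbT.
  move=> gc; have /nmax : P (size (a :: (w :: m) ++ b :: c2)).
    by apply/asboolP; exists (a :: (w :: m) ++ b :: c2).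
  by rewrite -sn sz -szc /= size_cat /=; clear; lia.
case/splitPr E: {1}c' / bc' => [q1 q2].
case: q1 E => [|u1 q1] E.
  by apply: (shortcut q2); [move: us | move=> v; rewrite sE |]; rewrite E.
(* Here [b] precedes [a] on the cycle, so the cycle is reversed before the ear is inserted. *)
case: (posnP (size q2)) => [/size0nil q20|q2s].
  apply: (shortcut (rev (u1 :: q1))).
  - have -> : b :: rev (u1 :: q1) = rev c' by rewrite E q20 rev_cat.
    exact: ucycle_rev.
  - move=> v; rewrite sE E q20 !(inE, mem_rev, mem_cat).
    by case: (v == a); case: (v == b); case: (v == u1); case: (v \in q1).
  - by rewrite E q20 /= size_rev size_cat /= addn1.
have cons_count z' y q : count_mem z' (y :: q) = (y == z') + count_mem z' q by [].
have rcons_count z' y q : count_mem z' (rcons q y) = count_mem z' q + (y == z').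
  by rewrite -cats1 count_cat /= addn0.
move: us; rewrite E => /andP[cyc uc].
have cnt v : (a == v) + ((u1 == v) + (count_mem v q1 + ((b == v) + count_mem v q2))) <= 1.
  by have := uniq_count v uc; rewrite /= count_cat.
move: cyc; rewrite /= rcons_cat /= cat_path /= => /and4P[au1 u1q1 q1b].
rewrite rcons_path => /andP[bq2 q2a].
have [u2 u2E] : exists u2, u2 = last b q2 by exists (last b q2).
have u2q2 : u2 \in q2 by rewrite u2E; case: (q2) q2s => //= v l _; exact: mem_last.
have u20 := mem_count u2q2.
have Xnot (X : {set G}) q : {in X, forall z, count_mem z q = 0} -> {in q, forall z, z \notin X}.
  by move=> Xq v vq; apply/negP => /Xq; have := mem_count vq; clear; lia.
have notw v : v \in s -> v != w by apply: contraTneq => ->.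
have u1s : u1 \in s by rewrite sE E !inE eqxx orbT.
have u2s : u2 \in s by rewrite sE E inE mem_cat !inE u2q2 !orbT.
have w0' q : {subset q <= s} -> count_mem w q = 0.
  by move=> qs; apply/eqP; rewrite eqn0Ngt -has_count has_pred1; apply: contra ws; exact: qs.
apply: (tf a b u1 u2 w) => //.
- by rewrite u2E adj_sym.
- rewrite /= !inE negb_or andbT !notw // !andbT; apply/eqP => u12.
  by move: (cnt u2) u20; rewrite u12 eqxx; clear; lia.
- have -> : b = last u1 (rcons q1 b) by rewrite last_rcons.
  apply: joined_path; first by rewrite rcons_path u1q1.
  apply: Xnot => v; rewrite !inE; case/orP=> [/orP[]|] /eqP ->.
  + by rewrite cons_count rcons_count; move: (cnt a); rewrite eqxx; clear; lia.
  + by rewrite cons_count rcons_count; move: (cnt u2) u20; clear; lia.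
  + apply: w0' => t tq; rewrite sE E.
    by move: tq; rewrite -cats1 !(inE, mem_cat) => /or3P[] ->; rewrite ?orbT.
- apply: joined_sym; rewrite u2E; apply: joined_path => //.
  apply: Xnot => v; rewrite !inE; case/orP=> [/orP[]|] /eqP ->.
  + by rewrite cons_count; move: (cnt a); rewrite eqxx; clear; lia.
  + by rewrite cons_count; move: (cnt u1); rewrite eqxx; clear; lia.
  + apply: w0' => t tq; rewrite sE E.
    by rewrite inE mem_cat tq !orbT.
- have -> : b = last w (rcons m b) by rewrite last_rcons.
  apply: joined_path; first by rewrite rcons_path wm.
  move=> v; rewrite -rcons_cons mem_rcons inE => /orP[/eqP ->|/ms vs].
    rewrite !inE; apply/negP; case/orP=> [/orP[]|] /eqP bE.
    + by rewrite bE eqxx in ba.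
    + by move: (cnt u1); rewrite bE !eqxx; clear; lia.
    + by move: (cnt u2) u20; rewrite bE !eqxx; clear; lia.
  by rewrite !inE; apply: contra vs => /orP[/orP[]|] /eqP ->.
Qed.
End Hamilton.

(** * Incidences *)

Section Incidences.
Variable G : sgraph.
Implicit Types (u v w : G) (i j l : incidence G).

(** The end of the edge other than [inc_vertex i]; by [farP] the default value never occurs. *)
Definition far i : G := odflt (inc_vertex i)
  [pick w | adj (inc_vertex i) w && (inc_edge i == [set inc_vertex i; w]%SET)].

Lemma farP i : adj (inc_vertex i) (far i) /\ inc_edge i = [set inc_vertex i; far i]%SET.
Proof.
rewrite /far; case: pickP => [w /andP[aw /eqP ew] //|H]; exfalso.
have /andP[] := valP i; rewrite inE => /existsP[x /existsP[y /andP[xy /eqP eE]]].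
rewrite eE !inE => /orP[] /eqP uE.
  by have := H y; rewrite /inc_vertex /inc_edge uE xy eE eqxx.
by have := H x; rewrite /inc_vertex /inc_edge uE adj_sym xy eE finset.setUC eqxx.
Qed.

Lemma far_adj i : adj (inc_vertex i) (far i). Proof. by have [] := farP i. Qed.

Lemma inc_eq i j : inc_vertex i = inc_vertex j -> far i = far j -> i = j.
Proof.
move=> vE fE; apply: val_inj; rewrite [val i]surjective_pairing [val j]surjective_pairing.
by congr (_, _) => //; rewrite -/(inc_edge i) -/(inc_edge j) (farP i).2 (farP j).2 vE fE.
Qed.

Lemma far_eq i w : inc_edge i = [set inc_vertex i; w]%SET -> far i = w.
Proof.
rewrite (farP i).2 => E.
have : far i \in [set inc_vertex i; w]%SET by rewrite -E !inE eqxx orbT.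
rewrite !inE => /orP[] /eqP // fE.
by have := far_adj i; rewrite fE adj_irrefl.
Qed.

Lemma third_adj_far i j : third_adj (inr i) (inr j) ->
  far i = inc_vertex j /\ far j = inc_vertex i.
Proof.
have main i' j' : third_adj (inr i') (inr j') -> far i' = inc_vertex j'.
  move=> /andP[/eqP eE vN].
  have : inc_vertex j' \in inc_edge i' by rewrite eE (farP j').2 !inE eqxx.
  by rewrite (farP i').2 !inE eq_sym (negbTE vN) => /eqP.
move=> ij; split; first exact: main.
by apply: main; move: ij; rewrite -[third_adj _ _]/(@adj (third_subdivision G) _ _) adj_sym.
Qed.

(** An incidence gets the value of [d] at its far end, so each [I2 v] gets the single colour [d v].
    Within distance 3, distinct vertices are adjacent, distinct incidences have far ends that are
    adjacent or have a common neighbour, and a vertex lies in the closed neighbourhood of the far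
    end of an incidence. *)
Lemma vi_pair_coloring k (c d : G -> 'I_k) : vi_pair [set: G]%SET c d ->
  exists f : G + incidence G -> 'I_k, ks_coloring 1 f.
Proof.
move=> [cd pc pd cdadj].
have inT (v : G) : v \in [set: G]%SET by rewrite inE.
have cdN u : c u <> d u by exact: cd.
have cN u v : adj u v -> c u <> c v by exact: pc.
have dN u v : adj u v -> d u <> d v.
  move=> uv; apply: pd => //; rewrite /near_in uv andbT.
  by apply: contraTneq uv => ->; rewrite adj_irrefl.
have d2N u v w : adj u v -> adj u w -> v <> w -> d v <> d w.
  move=> uv uw /eqP vw; apply: pd => //; rewrite /near_in vw /=; apply/orP; right.
  by apply/existsP; exists u; rewrite inE adj_sym uv.
have cdAN u v : adj u v -> c u <> d v by exact: cdadj.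
pose f (x : G + incidence G) := match x with inl v => c v | inr i => d (far i) end.
exists f; split; last first.
  move=> v; rewrite -(cards1 (d v)); apply/subset_leq_card/fintype.subsetP => a.
  move=> /imsetP[i + ->]; rewrite [i \in _]inE => /existsP[u /andP[_ /eqP iE]].
  by rewrite inE /= (@far_eq i v) // /inc_edge /inc_vertex iE.
have S (x y : 'I_k) : x <> y -> y <> x by move=> H E; apply: H.
have A i := far_adj i.
have A' i : adj (far i) (inc_vertex i) by rewrite adj_sym.
(* The witness [p] is a walk and may backtrack, so every pattern of vertices and incidences has to
   be treated. *)
move=> x y xy [p [pp lp sp]].
case: p pp lp sp => [|z1 [|z2 [|z3 [|//]]]] /=.
- by move=> _ /xy.
- rewrite andbT => a1 E _; subst z1.
  case: x y a1 xy => [u|i] [v|j] //=.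
  + by move=> /eqP <- _; exact: cdAN.
  + by move=> /eqP <- _; apply: S; exact: cdAN.
  + by move=> /third_adj_far[-> _] _; exact: dN.
- rewrite andbT => /andP[a1 a2] E _; subst z2.
  case: x z1 y a1 a2 xy => [u|i] [v|j] [w|l] //=.
  + by move=> /eqP -> /eqP ->.
  + by move=> /eqP <- /third_adj_far[_ ->] _; exact: cdN.
  + move=> /eqP vi /eqP vl il; apply: (d2N v); [by rewrite -vi | by rewrite -vl |].
    by move=> fE; apply: il; congr inr; apply: inc_eq => //; rewrite vi.
  + by move=> /third_adj_far[-> _] /eqP -> _; apply: S; exact: cdN.
  + move=> /third_adj_far[h1 h2] /third_adj_far[h3 h4] il; case: il; congr inr.
    by apply: inc_eq; [rewrite -h2 h3 | rewrite h1 h4].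
- rewrite andbT => /and3P[a1 a2 a3] E _; subst z3.
  case: x z1 z2 y a1 a2 a3 xy => [u|i] [v|j] [w|l] [t|n] //=.
  + by move=> /eqP <- /eqP -> /eqP <- _; exact: cdAN.
  + by move=> /eqP <- /third_adj_far[h1 _] /eqP <- _; rewrite -h1; exact: cN.
  + move=> /eqP <- /third_adj_far[h1 h2] /third_adj_far[h3 h4] _.
    by apply: cdAN; rewrite -h2 h3.
  + by move=> /eqP <- /eqP h1 /eqP <- _; rewrite h1; apply: S; exact: cdAN.
  + by move=> /eqP <- /eqP h1 /third_adj_far[_ ->] _; rewrite h1; exact: dN.
  + by move=> /third_adj_far[-> _] /eqP -> /eqP <- _; exact: dN.
  + move=> /third_adj_far[h1 h2] /third_adj_far[h3 h4] /eqP <- _.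
    by rewrite -h3 h2; apply: S; exact: cdAN.
  + move=> /third_adj_far[h1 h2] /third_adj_far[h3 h4] /third_adj_far[h5 h6] _.
    by rewrite h6 -h3 h2; exact: dN.
Qed.
End Incidences.

(** * Mod 2 winding numbers in the plane *)

Section PlaneTopology.
Import Order.TTheory GRing.Theory Num.Theory.
Import numFieldNormedType.Exports.
Local Open Scope classical_set_scope.
Local Open Scope ring_scope.

(** Since [r] holds locally, the class of [x] and its complement in [A] are both relatively open. *)
Lemma connected_equivalence (T : topologicalType) (A : set T)
    (r : T -> T -> Prop) :
  connected A -> (forall x y, r x y -> r y x) ->
  (forall x y z, r x y -> r y z -> r x z) ->
  (forall x, A x -> nbhs x [set y | A y -> r x y]) ->
  forall x y, A x -> A y -> r x y.
Proof.
move=> cA rsym rtrans rloc x y Ax Ay.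
have rxx : r x x by exact: (nbhs_singleton (rloc x Ax)).
pose O (P : set T) := \bigcup_(u in A `&` P) [set w | A w -> r u w]°.
have OO P : open (O P) by apply: bigcup_open => u _; exact: open_interior.
have AO (P : set T) u : A u -> P u -> O P u by move=> Au Pu; exists u => //; exact: rloc.
have rO u w : [set w | A w -> r u w]° w -> A w -> r u w.
  by move=> /interior_subset.
suff : A `&` [set w | r x w] = A by move=> /seteqP[_ /(_ y Ay)[]].
apply: cA; first by exists x.
- exists (O [set w | r x w]) => //; apply/seteqP; split=> w [Aw].
    by move=> rxw; split=> //; apply: AO.
  by move=> [u [Au rxu] /rO/(_ Aw) ruw]; split=> //=; apply: rtrans rxu ruw.
- exists (~` O [set w | ~ r x w]); first exact: open_closedC.
  apply/seteqP; split=> w [Aw].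
    move=> rxw; split=> // -[u [Au nrxu] /rO/(_ Aw) ruw].
    by apply: nrxu; apply: rtrans rxw (rsym _ _ ruw).
  by move=> nO; split=> //=; apply/not_notP => nr; apply: nO; apply: AO.
Qed.

Section Mod2Chains.
Variable R : realType.
Implicit Types (p q z x y : R * R) (E : seq ((R * R) * (R * R))) (K U : set (R * R)).

(* [p, q] crosses the rightward ray from [z]; this is exact only when [z] lies
   outside the bounding box of [p] and [q]. *)
Definition crosses z p q : bool :=
  ((p.2 <= z.2) (+) (q.2 <= z.2)) && (z.1 < p.1).

Definition wind E z : bool := \big[addb/false]_(e <- E) crosses z e.1 e.2.

Definition boundary E (F : R * R -> bool) : bool :=
  \big[addb/false]_(e <- E) (F e.1 (+) F e.2).

(* Boundaries are tested against all indicator functions [F], so that chains need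
   neither an order nor an orientation. *)
Definition joins E x y := forall F, boundary E F = F x (+) F y.
Definition cyclic_chain E := forall F, boundary E F = false.

Lemma wind_cat E E' z : wind (E ++ E') z = wind E z (+) wind E' z.
Proof. by rewrite /wind big_cat. Qed.

Lemma boundary_cat E E' F : boundary (E ++ E') F = boundary E F (+) boundary E' F.
Proof. by rewrite /boundary big_cat. Qed.

(** A horizontal or vertical line strictly separates the points [p], [q] from [z], [z']. *)
Definition apart p q z z' : bool :=
  [|| [&& p.1 < z.1, p.1 < z'.1, q.1 < z.1 & q.1 < z'.1],
      [&& z.1 < p.1, z'.1 < p.1, z.1 < q.1 & z'.1 < q.1],
      [&& p.2 < z.2, p.2 < z'.2, q.2 < z.2 & q.2 < z'.2] |
      [&& z.2 < p.2, z'.2 < p.2, z.2 < q.2 & z'.2 < q.2]].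

(** Moving the ray from [z] to [z'] changes the crossing parity by a coboundary. Since [F] depends
    on [z] and [z'] only, the changes cancel along a cyclic chain. *)
Lemma crosses_apart p q z z' : apart p q z z' ->
  let F w := ((w.2 <= z.2) (+) (w.2 <= z'.2)) && (z.1 < w.1) in
  crosses z p q (+) crosses z' p q = F p (+) F q.
Proof.
rewrite /apart /crosses => /or4P[] /and4P[a b c d] /=.
- by rewrite !ltNge !(ltW a, ltW b, ltW c, ltW d) /= !andbF.
- by rewrite a b c !andbT; do 4![case: (_ <= _)].
- by rewrite !(ltW a, ltW b, ltW c, ltW d).
- by rewrite !leNgt a b c d.
Qed.

Lemma wind_apart E z z' : cyclic_chain E ->
  (forall e, e \in E -> apart e.1 e.2 z z') -> wind E z = wind E z'.
Proof.
move=> cE aE; suff : wind E z (+) wind E z' = false by case: (wind E z) (wind E z') => -[].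
rewrite -(cE (fun w => ((w.2 <= z.2) (+) (w.2 <= z'.2)) && (z.1 < w.1))).
rewrite /wind /boundary -big_split /= big_seq [RHS]big_seq.
by apply: eq_bigr => e /aE/crosses_apart.
Qed.

Lemma square_ballP z w (e : R) : ball z e w <->
  [/\ z.1 - e < w.1, w.1 < z.1 + e, z.2 - e < w.2 & w.2 < z.2 + e].
Proof.
split=> [[]|].
  by rewrite -!ball_normE /= !ltr_norml => /andP[a b] /andP[c d]; split; lra.
move=> [a b c d]; split; rewrite -ball_normE /= ltr_norml; apply/andP; split; lra.
Qed.

(** Only the ends of an edge are required to lie in [K], not the segment between them. *)
Definition fine_in K (eps : R) E :=
  forall e, e \in E -> [/\ K e.1, K e.2 & ball e.1 eps e.2].

Lemma fine_in_cat K eps E E' :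
  fine_in K eps E -> fine_in K eps E' -> fine_in K eps (E ++ E').
Proof. by move=> fE fE' e; rewrite mem_cat => /orP[/fE|/fE']. Qed.

Lemma fine_inS K K' eps E : K `<=` K' -> fine_in K eps E -> fine_in K' eps E.
Proof. by move=> KK' fE e /fE[/KK' ? /KK' ? ?]. Qed.

Lemma fine_in_le K (e e' : R) E : e <= e' -> fine_in K e E -> fine_in K e' E.
Proof. by move=> ee fE f /fE[? ? /(le_ball ee) ?]. Qed.

(** Being joined by a fine chain is an equivalence relation on [K] that holds locally, by single
    edges. Thus connectedness of [K] suffices, without any path in [K]. *)
Lemma fine_chain K eps x y : connected K -> 0 < eps -> K x -> K y ->
  exists2 E, joins E x y & fine_in K eps E.
Proof.
move=> cK e0; move: x y; apply: connected_equivalence => //.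
- by move=> x y [E jE fE]; exists E => // F; rewrite jE addbC.
- move=> x y z [E jE fE] [E' jE' fE']; exists (E ++ E'); last exact: fine_in_cat.
  by move=> F; rewrite boundary_cat jE jE'; case: (F x) (F y) (F z) => [] [] [].
- move=> x Kx; apply/nbhs_ballP; exists eps => // y xy Ky.
  exists [:: (x, y)]; first by move=> F; rewrite /boundary big_seq1.
  by move=> e; rewrite inE => /eqP ->.
Qed.

(** The fixed edges to which this is applied lie along the sides of a square, where the box is the
    segment itself. *)
Definition in_bbox p q z : Prop :=
  ((p.1 <= z.1 <= q.1) || (q.1 <= z.1 <= p.1)) &&
  ((p.2 <= z.2 <= q.2) || (q.2 <= z.2 <= p.2)).

Lemma not_in_bbox_apart p q z : ~ in_bbox p q z ->
  exists2 d, 0 < d & forall z', ball z d z' -> apart p q z z'.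
Proof.
have sep (a b c : R) : ~~ ((a <= c <= b) || (b <= c <= a)) -> exists2 d, 0 < d &
   forall c', c - d < c' -> c' < c + d ->
     [&& a < c, a < c', b < c & b < c'] || [&& c < a, c' < a, c < b & c' < b].
  have [ac|ca] := ltP a c; have [bc|cb] := ltP b c; move=> H.
  - exists (Num.min (c - a) (c - b)); first by rewrite lt_min; lra.
    move=> c' h1 _; have : c - c' < Num.min (c - a) (c - b) by lra.
    by rewrite lt_min => /andP[h2 h3]; lra.
  - by exfalso; move: H => /negP; apply; lra.
  - by exfalso; move: H => /negP; apply; lra.
  - have {H} [h1 h2] : c < a /\ c < b.
      move: H; rewrite negb_or !negb_and -!ltNge.
      by move=> /andP[/orP[] h1 /orP[] h2]; lra.
    exists (Num.min (a - c) (b - c)); first by rewrite lt_min; lra.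
    move=> c' _ h; have : c' - c < Num.min (a - c) (b - c) by lra.
    by rewrite lt_min => /andP[h3 h4]; lra.
move=> /negP; rewrite negb_and => /orP[] /sep[d d0 dP]; exists d => // z'.
  by move/square_ballP => [h1 h2 _ _]; rewrite /apart orbA (dP _ h1 h2).
by move/square_ballP => [_ _ h1 h2]; rewrite /apart !orbA -(orbA (_ || _)) (dP _ h1 h2) orbT.
Qed.

(** In some coordinate [p] is at least [d + d] away from [z], which leaves room for moving [q] away
    from [p] and [z'] away from [z] by less than [d] each. *)
Lemma fine_edge_apart K z (d : R) : 0 < d -> (forall w, ball z (d + d) w -> ~ K w) ->
  forall p q z', K p -> ball p d q -> ball z d z' -> apart p q z z'.
Proof.
move=> d0 zK p q z' Kp /square_ballP[a1 a2 a3 a4] /square_ballP[b1 b2 b3 b4].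
have : ~ ball z (d + d) p by move=> /zK.
rewrite square_ballP => H.
have [h1|h1] := ltP (z.1 - (d + d)) p.1; last by apply/or4P; constructor 1; lra.
have [h2|h2] := ltP p.1 (z.1 + (d + d)); last by apply/or4P; constructor 2; lra.
have [h3|h3] := ltP (z.2 - (d + d)) p.2; last by apply/or4P; constructor 3; lra.
have [h4|h4] := ltP p.2 (z.2 + (d + d)); last by apply/or4P; constructor 4; lra.
by case: H.
Qed.

(* [E0] is a fixed part of the chain, whose edges may be long. *)
Definition same_wind K E0 z z' := exists2 eps, 0 < eps &
  forall E, fine_in K eps E -> cyclic_chain (E0 ++ E) ->
    wind (E0 ++ E) z = wind (E0 ++ E) z'.

Lemma same_wind_sym K E0 z z' : same_wind K E0 z z' -> same_wind K E0 z' z.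
Proof. by move=> [e e0 eP]; exists e => // E fE cE; rewrite eP. Qed.

Lemma same_wind_trans K E0 x y z :
  same_wind K E0 x y -> same_wind K E0 y z -> same_wind K E0 x z.
Proof.
move=> [e e0 eP] [e' e'0 eP']; exists (Num.min e e'); first by rewrite lt_min e0.
move=> E fE cE; rewrite eP ?eP' //.
  by apply: fine_in_le fE; rewrite ge_min lexx orbT.
by apply: fine_in_le fE; rewrite ge_min lexx.
Qed.

(** For [z'] close to [z], every edge is apart from both points: the fine ones because [K] keeps a
    distance from [z], the fixed ones because [z] is outside their finitely many boxes. *)
Lemma same_wind_near K E0 z : closed K -> ~ K z ->
  (forall e, e \in E0 -> ~ in_bbox e.1 e.2 z) -> nbhs z (same_wind K E0 z).
Proof.
move=> clK nKz zE0.
have [d d0 dP] : exists2 d, 0 < d & forall w, ball z (d + d) w -> ~ K w.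
  have : nbhs z (~` K) by apply: open_nbhs_nbhs; split; [exact: closed_openC|].
  move=> /nbhs_ballP[d /= d0 dP]; exists (d / 2); first by rewrite divr_gt0.
  by move=> w; rewrite -splitr => /dP.
have [d' d'0 d'P] : exists2 d, 0 < d &
    forall z' e, ball z d z' -> e \in E0 -> apart e.1 e.2 z z'.
  elim: E0 zE0 {dP} => [|e E0 IH] zE0; first by exists 1.
  have [|d1 d10 d1P] := IH.
    by move=> f fE; apply: zE0 => //; rewrite inE fE orbT.
  have [d2 d20 d2P] := not_in_bbox_apart (zE0 e (mem_head _ _)).
  exists (Num.min d1 d2); first by rewrite lt_min d10.
  move=> z' f zz'; rewrite inE => /orP[/eqP -> | fE].
    by apply: d2P; apply: le_ball zz'; rewrite ge_min lexx orbT.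
  by apply: d1P => //; apply: le_ball zz'; rewrite ge_min lexx.
apply/nbhs_ballP; exists (Num.min d d'); first by rewrite /= lt_min d0.
move=> z' zz'; exists d => // E fE cE; apply: wind_apart => // e.
rewrite mem_cat => /orP[eE|/fE[Ke1 _ e12]].
  by apply: d'P => //; apply: le_ball zz'; rewrite ge_min lexx orbT.
apply: (fine_edge_apart d0 dP) => //.
by apply: le_ball zz'; rewrite ge_min lexx.
Qed.

(** The tolerance in [same_wind] depends on the two points only and may shrink under transitivity,
    so local constancy spreads over the connected set [U]. *)
Lemma same_wind_connected U K E0 : connected U -> closed K ->
  (forall z, U z -> ~ K z) ->
  (forall z e, U z -> e \in E0 -> ~ in_bbox e.1 e.2 z) ->
  forall z z', U z -> U z' -> same_wind K E0 z z'.
Proof.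
move=> cU clK UK UE0; apply: connected_equivalence => //.
- exact: same_wind_sym.
- exact: same_wind_trans.
- move=> z Uz; apply: (@filterS _ _ _ (same_wind K E0 z)); first by move=> w h _.
  by apply: same_wind_near => //; [exact: UK | move=> e; exact: UE0].
Qed.

(** If [z] is to the left of the square, every edge starts to the right of [z], and the crossings
    reduce to the boundary of the height test, which is zero. In the other positions no edge crosses
    the ray. *)
Lemma wind_outside_square (a z : R * R) (r : R) E : cyclic_chain E ->
  (forall e, e \in E -> ball a r e.1 /\ ball a r e.2) -> ~ ball a r z ->
  wind E z = false.
Proof.
move=> cE bE /square_ballP nz.
have [z1|z1] := leP z.1 (a.1 - r).
  rewrite -(cE (fun w => w.2 <= z.2)) /wind /boundary big_seq [RHS]big_seq.
  apply: eq_bigr => e /bE[/square_ballP[a1 _ _ _] _]; rewrite /crosses.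
  by rewrite (le_lt_trans z1 a1) andbT.
rewrite /wind big_seq big1 // => e.
move=> /bE[/square_ballP[a1 a2 a3 a4] /square_ballP[b1 b2 b3 b4]]; rewrite /crosses.
have [z2|z2] := ltP z.1 (a.1 + r); last first.
  by rewrite ltNge (ltW (lt_le_trans a2 z2)) andbF.
have [z3|z3] := ltP (a.2 - r) z.2; last first.
  by rewrite !leNgt (le_lt_trans z3 a3) (le_lt_trans z3 b3).
have [z4|z4] := ltP z.2 (a.2 + r); first by case: nz.
by rewrite (ltW (lt_le_trans a4 z4)) (ltW (lt_le_trans b4 z4)).
Qed.

End Mod2Chains.

(** * Cutting the boundary of a square *)

Lemma eq_pt (R : realType) (z : R * R) x y : z.1 = x -> z.2 = y -> z = (x, y).
Proof. by case: z => ? ? /= -> ->. Qed.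

Section Square.
Variables (R : realType) (a : R * R) (r : R).
Hypothesis r_gt0 : 0 < r.
Implicit Types (s t k : R) (z e : R * R) (E : seq ((R * R) * (R * R))).

(** Parametrisation by arc length, counterclockwise from the lower left corner, with total length
    [8 * r]. *)
Definition perimeter k : R * R :=
  if k <= 2 * r then (a.1 - r + k, a.2 - r)
  else if k <= 4 * r then (a.1 + r, a.2 - 3 * r + k)
  else if k <= 6 * r then (a.1 + 5 * r - k, a.2 + r)
  else (a.1 - r, a.2 + 7 * r - k).

Lemma perimeter_bottom k : k <= 2 * r -> perimeter k = (a.1 - r + k, a.2 - r).
Proof. by rewrite /perimeter => ->. Qed.

Lemma perimeter_right k : 2 * r <= k -> k <= 4 * r ->
  perimeter k = (a.1 + r, a.2 - 3 * r + k).
Proof.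
move=> h1 h2; rewrite /perimeter h2; case: ifP => // h3.
by congr (_, _); lra.
Qed.

Lemma perimeter_top k : 4 * r <= k -> k <= 6 * r ->
  perimeter k = (a.1 + 5 * r - k, a.2 + r).
Proof.
have r0 := r_gt0; move=> h1 h2; rewrite /perimeter h2; case: ifP => h3; first by exfalso; lra.
by case: ifP => // h4; congr (_, _); lra.
Qed.

Lemma perimeter_left k : 6 * r <= k -> perimeter k = (a.1 - r, a.2 + 7 * r - k).
Proof.
have r0 := r_gt0; move=> h1; rewrite /perimeter; case: ifP => h2; first by exfalso; lra.
case: ifP => h3; first by exfalso; lra.
by case: ifP => // h4; congr (_, _); lra.
Qed.

Lemma square_norm z : `|z - a| = Num.max `|z.1 - a.1| `|z.2 - a.2|.
Proof. by []. Qed.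

Lemma perimeter_onto e : `|e - a| = r ->
  exists2 k, 0 <= k < 8 * r & e = perimeter k.
Proof.
have r0 := r_gt0; rewrite square_norm => H.
have : Num.max `|e.1 - a.1| `|e.2 - a.2| <= r by rewrite H.
rewrite ge_max !ler_norml => /andP[/andP[x1 x2] /andP[y1 y2]].
have [b|b] := leP e.2 (a.2 - r).
  exists (e.1 - a.1 + r); first by lra.
  by rewrite perimeter_bottom; [apply: eq_pt; lra | lra..].
have [c|c] := leP (a.1 + r) e.1.
  exists (e.2 - a.2 + 3 * r); first by lra.
  by rewrite perimeter_right; [apply: eq_pt; lra | lra..].
have [d|d] := leP (a.2 + r) e.2.
  exists (a.1 + 5 * r - e.1); first by lra.
  by rewrite perimeter_top; [apply: eq_pt; lra | lra..].
have [f|f] := leP e.1 (a.1 - r).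
  exists (a.2 + 7 * r - e.2); first by lra.
  by rewrite perimeter_left; [apply: eq_pt; lra | lra..].
suff : Num.max `|e.1 - a.1| `|e.2 - a.2| < r by rewrite H ltxx.
by rewrite gt_max !ltr_norml; lra.
Qed.

Lemma perimeter_cases k : 0 <= k -> k <= 8 * r ->
  [\/ 0 <= k <= 2 * r /\ perimeter k = (a.1 - r + k, a.2 - r),
      2 * r <= k <= 4 * r /\ perimeter k = (a.1 + r, a.2 - 3 * r + k),
      4 * r <= k <= 6 * r /\ perimeter k = (a.1 + 5 * r - k, a.2 + r) |
      6 * r <= k <= 8 * r /\ perimeter k = (a.1 - r, a.2 + 7 * r - k)].
Proof.
move=> h1 h2; have [k2|k2] := leP k (2 * r).
  by constructor 1; split; [lra | exact: perimeter_bottom].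
have [k4|k4] := leP k (4 * r).
  by constructor 2; split; [lra | apply: perimeter_right => //; exact: ltW].
have [k6|k6] := leP k (6 * r).
  by constructor 3; split; [lra | apply: perimeter_top => //; exact: ltW].
by constructor 4; split; [lra | apply: perimeter_left; exact: ltW].
Qed.

Lemma perimeter_norm k : 0 <= k -> k <= 8 * r -> `|perimeter k - a| = r.
Proof.
have r0 := r_gt0; move=> h1 h2; apply/eqP.
rewrite square_norm eq_le ge_max le_max !ler_norml !ler_normr.
by case: (perimeter_cases h1 h2) => -[/andP[k1 k2] ->] /=; lra.
Qed.

Lemma perimeter_inj s t : 0 <= s -> s <= t -> t <= 8 * r ->
  perimeter s = perimeter t -> s = t \/ s = 0 /\ t = 8 * r.
Proof.
have r0 := r_gt0; move=> s0 st t8.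
have s8 := le_trans st t8; have t0 := le_trans s0 st.
by case: (perimeter_cases s0 s8) => -[/andP[s1 s2] ->];
   case: (perimeter_cases t0 t8) => -[/andP[t1 t2] ->];
   move=> /eqP; rewrite xpair_eqE => /andP[/eqP h1 /eqP h2]; by [left; lra | right; lra].
Qed.

(* The ray from [a] to the right meets the square at parameter [3 * r]. *)
Definition perimeter_arc k k' := exists E, [/\ joins E (perimeter k) (perimeter k'),
  (forall f z, f \in E -> in_bbox f.1 f.2 z -> exists2 t, k <= t <= k' & z = perimeter t) &
  wind E a = (k <= 3 * r) (+) (k' <= 3 * r)].

Lemma perimeter_arc_trans k m k' : k <= m -> m <= k' ->
  perimeter_arc k m -> perimeter_arc m k' -> perimeter_arc k k'.
Proof.
move=> km mk [E [jE bE wE]] [E' [jE' bE' wE']]; exists (E ++ E'); split.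
- by move=> F; rewrite boundary_cat jE jE' addbA addbK.
- move=> e z; rewrite mem_cat => /orP[/bE h /h|/bE' h /h] [t /andP[t1 t2] ->].
    by exists t => //; rewrite t1 (le_trans t2).
  by exists t => //; rewrite t2 (le_trans km).
- by rewrite wind_cat wE wE' addbA addbK.
Qed.

Lemma perimeter_arc_edge k k' : k <= k' ->
  (forall z, in_bbox (perimeter k) (perimeter k') z ->
     exists2 t, k <= t <= k' & z = perimeter t) ->
  crosses a (perimeter k) (perimeter k') = (k <= 3 * r) (+) (k' <= 3 * r) ->
  perimeter_arc k k'.
Proof.
move=> kk bb cr; exists [:: (perimeter k, perimeter k')]; split.
- by move=> F; rewrite /boundary big_seq1.
- by move=> e z; rewrite inE => /eqP ->; exact: bb.
- by rewrite /wind big_seq1.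
Qed.

(** Within one side of the square a single edge will do, its box being part of that side; longer
    arcs are cut at the corners. Only the right side can meet the ray from [a]. *)
Lemma perimeter_arcP k k' : 0 <= k -> k <= k' -> k' <= 8 * r -> perimeter_arc k k'.
Proof.
have r0 := r_gt0; have bot s t : 0 <= s -> s <= t -> t <= 2 * r -> perimeter_arc s t.
  move=> h1 h2 h3; apply: perimeter_arc_edge => //.
    rewrite !perimeter_bottom; [|lra..].
    move=> z; rewrite /in_bbox /= => H; exists (z.1 - a.1 + r); first by lra.
    by rewrite perimeter_bottom; [apply: eq_pt; lra | lra..].
  rewrite !perimeter_bottom /crosses /=; [|lra..].
  rewrite addbb; apply/esym/negbTE; rewrite negb_add.
  by apply/eqP; apply/idP/idP; lra.
have rgt s t : 2 * r <= s -> s <= t -> t <= 4 * r -> perimeter_arc s t.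
  move=> h1 h2 h3; apply: perimeter_arc_edge => //.
    rewrite !perimeter_right; [|lra..].
    move=> z; rewrite /in_bbox /= => H; exists (z.2 - a.2 + 3 * r); first by lra.
    by rewrite perimeter_right; [apply: eq_pt; lra | lra..].
  rewrite !perimeter_right /crosses /=; [|lra..].
  rewrite (_ : a.1 < a.1 + r) ?andbT; last by lra.
  by congr (_ (+) _); apply/idP/idP; lra.
have top s t : 4 * r <= s -> s <= t -> t <= 6 * r -> perimeter_arc s t.
  move=> h1 h2 h3; apply: perimeter_arc_edge => //.
    rewrite !perimeter_top; [|lra..].
    move=> z; rewrite /in_bbox /= => H; exists (a.1 + 5 * r - z.1); first by lra.
    by rewrite perimeter_top; [apply: eq_pt; lra | lra..].
  rewrite !perimeter_top /crosses /=; [|lra..].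
  rewrite addbb; apply/esym/negbTE; rewrite negb_add.
  by apply/eqP; apply/idP/idP; lra.
have lft s t : 6 * r <= s -> s <= t -> t <= 8 * r -> perimeter_arc s t.
  move=> h1 h2 h3; apply: perimeter_arc_edge => //.
    rewrite !perimeter_left; [|lra..].
    move=> z; rewrite /in_bbox /= => H; exists (a.2 + 7 * r - z.2); first by lra.
    by rewrite perimeter_left; [apply: eq_pt; lra | lra..].
  rewrite !perimeter_left /crosses /=; [|lra..].
  rewrite (_ : a.1 < a.1 - r = false) ?andbF; last by apply/negbTE; lra.
  apply/esym/negbTE; rewrite negb_add.
  by apply/eqP; apply/idP/idP; lra.
have two s t : 0 <= s -> s <= t -> t <= 4 * r -> perimeter_arc s t.
  move=> h1 h2 h3; have [h4|h4] := leP t (2 * r); first exact: bot.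
  have [h5|h5] := leP (2 * r) s; first exact: rgt.
  by apply: (@perimeter_arc_trans _ (2 * r)); [lra | lra | apply: bot | apply: rgt]; lra.
have three s t : 0 <= s -> s <= t -> t <= 6 * r -> perimeter_arc s t.
  move=> h1 h2 h3; have [h4|h4] := leP t (4 * r); first exact: two.
  have [h5|h5] := leP (4 * r) s; first exact: top.
  by apply: (@perimeter_arc_trans _ (4 * r)); [lra | lra | apply: two | apply: top]; lra.
move=> h1 h2 h3; have [h4|h4] := leP k' (6 * r); first exact: three.
have [h5|h5] := leP (6 * r) k; first exact: lft.
by apply: (@perimeter_arc_trans _ (6 * r)); [lra | lra | apply: three | apply: lft]; lra.
Qed.

Definition on_square_off E e :=
  forall f z, f \in E -> in_bbox f.1 f.2 z -> `|z - a| = r /\ z <> e.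

(** The last clause says that the whole boundary winds once, mod 2, around [a]. *)
Definition square_cut e1 e2 e3 := exists A12 A23 A31,
  [/\ joins A12 e1 e2 /\ on_square_off A12 e3,
      joins A23 e2 e3 /\ on_square_off A23 e1,
      joins A31 e3 e1 /\ on_square_off A31 e2 &
      wind A12 a (+) wind A23 a (+) wind A31 a].

Lemma joinsC E x y : joins E x y -> joins E y x.
Proof. by move=> jE F; rewrite jE addbC. Qed.

Lemma square_cut_rot e1 e2 e3 : square_cut e1 e2 e3 -> square_cut e2 e3 e1.
Proof.
move=> [A12 [A23 [A31 [h1 h2 h3 h4]]]]; exists A23, A31, A12.
by split=> //; rewrite addbC addbA.
Qed.

Lemma square_cut_swap e1 e2 e3 : square_cut e1 e2 e3 -> square_cut e2 e1 e3.
Proof.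
move=> [A12 [A23 [A31 [[/joinsC h1 o1] [/joinsC h2 o2] [/joinsC h3 o3] h4]]]].
by exists A12, A31, A23; split=> //; rewrite addbAC.
Qed.

(** The third arc passes the corner where the parameter [8 * r] restarts at 0. The winding parities
    telescope to the tests at 0 and [8 * r], which lie on different sides of [3 * r]. *)
Lemma square_cut_sorted k1 k2 k3 : 0 <= k1 -> k1 < k2 -> k2 < k3 -> k3 < 8 * r ->
  square_cut (perimeter k1) (perimeter k2) (perimeter k3).
Proof.
have r0 := r_gt0; move=> h0 h1 h2 h3.
have [A12 [j1 b1 w1]] : perimeter_arc k1 k2 by apply: perimeter_arcP; lra.
have [A23 [j2 b2 w2]] : perimeter_arc k2 k3 by apply: perimeter_arcP; lra.
have [A3 [j3 b3 w3]] : perimeter_arc k3 (8 * r) by apply: perimeter_arcP; lra.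
have [A1 [j4 b4 w4]] : perimeter_arc 0 k1 by apply: perimeter_arcP; lra.
have p08 : perimeter (8 * r) = perimeter 0.
  by rewrite perimeter_left ?perimeter_bottom; [congr (_, _); lra | lra..].
exists A12, A23, (A3 ++ A1); split.
- split=> // f z fA /(b1 _ _ fA)[t /andP[t1 t2] ->]; split; first by apply: perimeter_norm; lra.
  by move=> /perimeter_inj[]; lra.
- split=> // f z fA /(b2 _ _ fA)[t /andP[t1 t2] ->]; split; first by apply: perimeter_norm; lra.
  by move=> /esym/perimeter_inj[]; lra.
- split; first by move=> F; rewrite boundary_cat j3 j4 p08 addbA addbK.
  move=> f z; rewrite mem_cat => /orP[] fA.
    move=> /(b3 _ _ fA)[t /andP[t1 t2] ->]; split; first by apply: perimeter_norm; lra.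
    by move=> /esym/perimeter_inj[]; lra.
  move=> /(b4 _ _ fA)[t /andP[t1 t2] ->]; split; first by apply: perimeter_norm; lra.
  by move=> /perimeter_inj[]; lra.
- rewrite wind_cat w1 w2 w3 w4 (_ : 0 <= 3 * r); last by lra.
  rewrite (_ : 8 * r <= 3 * r = false); last by apply/negbTE; lra.
  by case: (k1 <= _) (k2 <= _) (k3 <= _) => [] [] [].
Qed.

Lemma square_cutP e1 e2 e3 : `|e1 - a| = r -> `|e2 - a| = r -> `|e3 - a| = r ->
  e1 <> e2 -> e2 <> e3 -> e3 <> e1 -> square_cut e1 e2 e3.
Proof.
move=> /perimeter_onto[k1 /andP[a1 b1] ->] /perimeter_onto[k2 /andP[a2 b2] ->].
move=> /perimeter_onto[k3 /andP[a3 b3] ->] n12 n23 n31.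
have [h|h|h] := ltgtP k1 k2; last by case: n12; rewrite h.
  have [h'|h'|h'] := ltgtP k2 k3; last by case: n23; rewrite h'.
    exact: square_cut_sorted.
  have [h2|h2|h2] := ltgtP k3 k1; last by case: n31; rewrite h2.
    by apply: square_cut_rot; exact: square_cut_sorted.
  by apply: square_cut_rot; apply: square_cut_swap; exact: square_cut_sorted.
have [h'|h'|h'] := ltgtP k1 k3; last by case: n31; rewrite h'.
  by apply: square_cut_swap; exact: square_cut_sorted.
have [h2|h2|h2] := ltgtP k2 k3; last by case: n23; rewrite h2.
  by do 2!apply: square_cut_rot; exact: square_cut_sorted.
by do 2!apply: square_cut_rot; apply: square_cut_swap; exact: square_cut_sorted.
Qed.

End Square.

(** * Three routes from a point *)

Section Theta.
Variables (R : realType) (a b p0 : R * R) (r rho : R) (F : set (R * R)).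
Hypotheses (r_gt0 : 0 < r) (r_rho : r < rho) (Fconn : connected F) (Fp0 : F p0).
Implicit Types (z u e : R * R) (I X K : set (R * R)) (E : seq ((R * R) * (R * R))).

(* A route from [a] through [u] to [b], cut at its last visit [e] to the square
   of radius [r] around [a]. *)
Record leg u e I X K : Prop := Leg {
  leg_Iclosed : closed I; leg_Iconn : connected I; leg_Ia : I a; leg_Ie : I e;
  leg_Iball : I `<=` ball a rho;
  leg_Xclosed : closed X; leg_Xconn : connected X; leg_Xe : X e; leg_Xu : X u;
  leg_e : `|e - a| = r;
  leg_Xout : forall z, X z -> z <> e -> r < `|z - a|;
  leg_Kclosed : closed K; leg_Kconn : connected K; leg_Ku : K u; leg_Kb : K b;
  leg_Kout : forall z, K z -> r < `|z - a|;
  leg_F : forall z, F z -> ~ (I `|` X `|` K) z;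
  leg_u : ~ ball a rho u;
  leg_Fu : closure F u }.

Lemma segment_to (e : R * R) : connected [set a + t *: (e - a) | t in `[0, 1] ].
Proof.
apply: connected_continuous_connected; first exact: segment_connected.
apply: continuous_subspaceT => t; apply: cvgD; first exact: cvg_cst.
by apply: cvgZr_tmp; exact: cvg_id.
Qed.

(** The point [ul] is connected to [a] by [Xl] followed by the straight segment from [el] to [a].
    This set avoids the outer parts of the other routes, and meets the boundary of the square only
    at [el], which the arc [A] avoids. *)
Lemma same_wind_center (ul el ej ek : R * R) Il Xl Kl Ij Xj Kj uj Ik Xk Kk uk A :
  leg ul el Il Xl Kl -> leg uj ej Ij Xj Kj -> leg uk ek Ik Xk Kk ->
  (forall z, Xl z -> ~ (Xj `|` Kj) z) -> (forall z, Xl z -> ~ (Xk `|` Kk) z) ->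
  on_square_off a r A el ->
  same_wind ((Xj `|` Kj) `|` (Xk `|` Kk)) A ul a.
Proof.
move=> ll lj lk dj dk Aoff.
have norm_seg t : 0 <= t -> `|a + t *: (el - a) - a| = t * r.
  by move=> t0; rewrite addrAC subrr add0r normrZ (leg_e ll) ger0_norm.
have seg_el z : [set a + t *: (el - a) | t in `[0, 1] ] z -> r <= `|z - a| -> z = el.
  move=> [t /=]; rewrite in_itv /= => /andP[t0 t1] <-; rewrite norm_seg //.
  rewrite -{1}(mul1r r) ler_pM2r // => t1'.
  have -> : t = 1 by apply/eqP; rewrite eq_le t1.
  by rewrite scale1r addrC subrK.
have Xr u e I X K z : leg u e I X K -> (X `|` K) z -> r <= `|z - a|.
  move=> l [Xz|/(leg_Kout l)/ltW //]; have [->|/eqP ne] := eqVneq z e; first by rewrite (leg_e l).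
  by rewrite ltW // (leg_Xout l).
apply: (@same_wind_connected _ (Xl `|` [set a + t *: (el - a) | t in `[0, 1] ])).
- apply: connectedU; [|exact: leg_Xconn ll|exact: segment_to].
  exists el; split; first exact: leg_Xe ll.
  by exists 1; rewrite /= ?in_itv /= ?lexx ?ler01 // scale1r addrC subrK.
- by repeat apply: closedU; [exact: leg_Xclosed lj | exact: leg_Kclosed lj
    | exact: leg_Xclosed lk | exact: leg_Kclosed lk].
- move=> z [Xz|sz].
    by move=> [/(dj _ Xz)|/(dk _ Xz)].
  move=> [h|h].
    have := seg_el _ sz (Xr _ _ _ _ _ _ lj h) => E; rewrite E in h.
    by apply: dj h; exact: leg_Xe ll.
  have := seg_el _ sz (Xr _ _ _ _ _ _ lk h) => E; rewrite E in h.
  by apply: dk h; exact: leg_Xe ll.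
- move=> z f Uz fA /(Aoff _ _ fA) [nz ze]; case: Uz => [Xz|/seg_el].
    by have := leg_Xout ll Xz ze; rewrite nz ltxx.
  by rewrite nz lexx => /(_ isT).
- by left; exact: leg_Xu ll.
- by right; exists 0; rewrite /= ?in_itv /= ?lexx ?ler01 // scale0r addr0.
Qed.

(** The point [ul] lies off the closed routes j and k, and in the closure of [F]. So the winding
    number agrees with that at a nearby point of [F], and it is constant on the connected set
    [F]. *)
Lemma same_wind_face (ul el ej ek : R * R) Il Xl Kl Ij Xj Kj uj Ik Xk Kk uk :
  leg ul el Il Xl Kl -> leg uj ej Ij Xj Kj -> leg uk ek Ik Xk Kk ->
  (forall z, Xl z -> ~ (Xj `|` Kj) z) -> (forall z, Xl z -> ~ (Xk `|` Kk) z) ->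
  same_wind ((Ij `|` Xj `|` Kj) `|` (Ik `|` Xk `|` Kk)) [::] ul p0.
Proof.
move=> ll lj lk dj dk.
set K := _ `|` _.
have clK : closed K.
  by do 2![apply: closedU]; repeat apply: closedU; by [exact: leg_Iclosed lj
   | exact: leg_Iclosed lk | exact: leg_Xclosed lj | exact: leg_Kclosed lj
   | exact: leg_Xclosed lk | exact: leg_Kclosed lk].
have nKul : ~ K ul.
  move=> [[[h|h]|h]|[[h|h]|h]].
  - by apply: (leg_u ll); apply: (leg_Iball lj).
  - by apply: (dj ul (leg_Xu ll)); left.
  - by apply: (dj ul (leg_Xu ll)); right.
  - by apply: (leg_u ll); apply: (leg_Iball lk).
  - by apply: (dk ul (leg_Xu ll)); left.
  - by apply: (dk ul (leg_Xu ll)); right.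
have /(leg_Fu ll)[y [Fy ry]] := @same_wind_near _ K [::] ul clK nKul (fun _ => ltac:(done)).
apply: same_wind_trans ry _; apply: (same_wind_connected Fconn clK) => // z Fz.
by move=> [/(leg_F lj Fz)|/(leg_F lk Fz)].
Qed.

(** Three cycles are compared at [ul]: [A] with the outer parts, the full cycle of routes j and k,
    and [A] with the inner parts. The third is the sum of the first two mod 2 and does not wind
    around [ul], so the first two agree there; they are then carried to [a] and to [p0]
    respectively. *)
Lemma leg_pair (ul el ej ek : R * R) Il Xl Kl Ij Xj Kj uj Ik Xk Kk uk A :
  leg ul el Il Xl Kl -> leg uj ej Ij Xj Kj -> leg uk ek Ik Xk Kk ->
  (forall z, Xl z -> ~ (Xj `|` Kj) z) -> (forall z, Xl z -> ~ (Xk `|` Kk) z) ->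
  joins A ej ek -> on_square_off a r A el ->
  exists2 eps, 0 < eps & forall Jj Qj Jk Qk,
    joins Jj a ej /\ fine_in Ij eps Jj -> joins Qj ej b /\ fine_in (Xj `|` Kj) eps Qj ->
    joins Jk a ek /\ fine_in Ik eps Jk -> joins Qk ek b /\ fine_in (Xk `|` Kk) eps Qk ->
    wind A a (+) wind Qj a (+) wind Qk a =
    (wind Jj p0 (+) wind Qj p0) (+) (wind Jk p0 (+) wind Qk p0).
Proof.
move=> ll lj lk dj dk jA Aoff.
have [e1 e10 e1P] := same_wind_center ll lj lk dj dk Aoff.
have [e2 e20 e2P] := same_wind_face ll lj lk dj dk.
exists (Num.min e1 e2); first by rewrite lt_min e10.
move=> Jj Qj Jk Qk [jJj fJj] [jQj fQj] [jJk fJk] [jQk fQk].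
have F1 K E : fine_in K (Num.min e1 e2) E -> fine_in K e1 E.
  by apply: fine_in_le; rewrite ge_min lexx.
have F2 K E : fine_in K (Num.min e1 e2) E -> fine_in K e2 E.
  by apply: fine_in_le; rewrite ge_min lexx orbT.
have H1 : wind (A ++ Qj ++ Qk) ul = wind (A ++ Qj ++ Qk) a.
  apply: e1P.
    apply: F1; apply: fine_in_cat; [apply: fine_inS fQj|apply: fine_inS fQk] => z h.
      by left.
    by right.
  by move=> G; rewrite !boundary_cat jA jQj jQk; case: (G ej) (G ek) (G b) => [] [] [].
have H2 : wind ((Jj ++ Qj) ++ Jk ++ Qk) ul = wind ((Jj ++ Qj) ++ Jk ++ Qk) p0.
  apply: e2P.
    apply: F2; apply: fine_in_cat; apply: fine_in_cat.
    - by apply: fine_inS fJj => z h; do 3!left.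
    - by apply: fine_inS fQj => z [h|h]; left; [left; right | right].
    - by apply: fine_inS fJk => z h; right; do 2!left.
    - by apply: fine_inS fQk => z [h|h]; right; [left; right | right].
  move=> G; rewrite cat0s !boundary_cat jJj jQj jJk jQk.
  by case: (G ej) (G ek) (G b) (G a) => [] [] [] [].
have H3 : wind (A ++ Jj ++ Jk) ul = false.
  apply: (@wind_outside_square _ a _ rho); last exact: leg_u ll.
    move=> G; rewrite !boundary_cat jA jJj jJk.
    by case: (G ej) (G ek) (G a) => [] [] [].
  have Aball z : `|z - a| = r -> ball a rho z.
    by move=> zr; rewrite -ball_normE /= -opprB normrN zr.
  move=> f; rewrite !mem_cat => /orP[fA|/orP[/fJj|/fJk]].
  - have [|n1 _] := Aoff _ f.1 fA.
      by rewrite /in_bbox !lexx !andbT /= !le_total.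
    have [|n2 _] := Aoff _ f.2 fA.
      by rewrite /in_bbox !lexx !andbT /= !le_total.
    by split; apply: Aball.
  - by move=> [h1 h2 _]; split; apply: (leg_Iball lj).
  - by move=> [h1 h2 _]; split; apply: (leg_Iball lk).
move: H1 H2 H3; rewrite !wind_cat => H1 H2 H3.
rewrite -[LHS]addbA -H1 -H2; move: H3.
by move: (wind A ul) (wind Jj ul) (wind Jk ul) (wind Qj ul) (wind Qk ul) => [] [] [] [] [].
Qed.

Lemma no_three_legs u1 e1 I1 X1 K1 u2 e2 I2 X2 K2 u3 e3 I3 X3 K3 :
  leg u1 e1 I1 X1 K1 -> leg u2 e2 I2 X2 K2 -> leg u3 e3 I3 X3 K3 ->
  (forall z, X1 z -> ~ (X2 `|` K2) z) -> (forall z, X1 z -> ~ (X3 `|` K3) z) ->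
  (forall z, X2 z -> ~ (X1 `|` K1) z) -> (forall z, X2 z -> ~ (X3 `|` K3) z) ->
  (forall z, X3 z -> ~ (X1 `|` K1) z) -> (forall z, X3 z -> ~ (X2 `|` K2) z) ->
  False.
Proof.
move=> l1 l2 l3 d12 d13 d21 d23 d31 d32.
have ne u e I X K u' e' I' X' K' : leg u e I X K -> leg u' e' I' X' K' ->
    (forall z, X z -> ~ (X' `|` K') z) -> e <> e'.
  move=> l l' d E; apply: (d e (leg_Xe l)); left.
  by rewrite E; exact: leg_Xe l'.
have [A12 [A23 [A31 [[j12 o3] [j23 o1] [j31 o2] w]]]] :=
  square_cutP r_gt0 (leg_e l1) (leg_e l2) (leg_e l3)
   (ne _ _ _ _ _ _ _ _ _ _ l1 l2 d12) (ne _ _ _ _ _ _ _ _ _ _ l2 l3 d23)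
   (ne _ _ _ _ _ _ _ _ _ _ l3 l1 d31).
have [d1 d10 h1] := leg_pair l3 l1 l2 d31 d32 j12 o3.
have [d2 d20 h2] := leg_pair l1 l2 l3 d12 d13 j23 o1.
have [d3 d30 h3] := leg_pair l2 l3 l1 d23 d21 j31 o2.
(* With a common tolerance, one chain per route serves in both pairs containing that route, so that
   the contributions cancel exactly. *)
pose d := Num.min d1 (Num.min d2 d3).
have d0 : 0 < d by rewrite !lt_min d10 d20.
have chains u e I X K : leg u e I X K -> exists JQ, forall d', d <= d' ->
    (joins JQ.1 a e /\ fine_in I d' JQ.1) /\ (joins JQ.2 e b /\ fine_in (X `|` K) d' JQ.2).
  move=> l; have [J jJ fJ] := fine_chain (leg_Iconn l) d0 (leg_Ia l) (leg_Ie l).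
  have cXK : connected (X `|` K).
    apply: connectedU; [|exact: leg_Xconn l|exact: leg_Kconn l].
    by exists u; split; [exact: leg_Xu l | exact: leg_Ku l].
  have [Q jQ fQ] := fine_chain cXK d0 (or_introl (leg_Xe l)) (or_intror (leg_Kb l)).
  by exists (J, Q) => d' dd'; do 2!split => //=; exact: fine_in_le dd' _.
have [[J1 Q1] /= c1] := chains _ _ _ _ _ l1.
have [[J2 Q2] /= c2] := chains _ _ _ _ _ l2.
have [[J3 Q3] /= c3] := chains _ _ _ _ _ l3.
have dd1 : d <= d1 by rewrite ge_min lexx.
have dd2 : d <= d2 by rewrite !ge_min lexx !orbT.
have dd3 : d <= d3 by rewrite !ge_min lexx !orbT.
move: w.
have := h1 _ _ _ _ (c1 _ dd1).1 (c1 _ dd1).2 (c2 _ dd1).1 (c2 _ dd1).2.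
have := h2 _ _ _ _ (c2 _ dd2).1 (c2 _ dd2).2 (c3 _ dd2).1 (c3 _ dd2).2.
have := h3 _ _ _ _ (c3 _ dd3).1 (c3 _ dd3).2 (c1 _ dd3).1 (c1 _ dd3).2.
move: (wind J1 p0 (+) _) (wind J2 p0 (+) _) (wind J3 p0 (+) _).
move: (wind A12 a) (wind A23 a) (wind A31 a) (wind Q1 a) (wind Q2 a) (wind Q3 a).
by do 9!case.
Qed.

End Theta.

(** * Drawings *)

(** Up to some time [tau] the curve stays in the square of radius [rho]; from [tau] on, its distance
    to [a] has a positive minimum. Half of this minimum serves as [r0], so the last visit to a
    square of radius [r <= r0] comes before [tau]. *)
Lemma last_visit (R : realType) (alpha : R -> R * R) (a : R * R) (rho : R) :
  {within `[0, 1], continuous alpha} -> alpha 0 = a ->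
  (forall t, 0 < t -> t <= 1 -> alpha t <> a) -> 0 < rho ->
  exists2 r0 : R, 0 < r0 & forall r : R, 0 < r -> r <= r0 -> exists s,
    [/\ 0 < s /\ s <= 1, `|alpha s - a| = r,
        forall t, s < t -> t <= 1 -> r < `|alpha t - a| &
        forall t, 0 <= t -> t <= s -> ball a rho (alpha t)].
Proof.
move=> calpha alpha0 alphaN rho0.
pose f t := `|alpha t - a|.
have cf : {within `[0, 1], continuous f}.
  by move=> x; apply: cvg_norm; apply: cvgB; [exact: calpha | exact: cvg_cst].
have f0 : f 0 = 0 by rewrite /f alpha0 subrr normr0.
have [tau [tau0 tau1] tauP] : exists2 tau, 0 < tau /\ tau <= 1 &
    forall t, 0 <= t -> t <= tau -> f t < rho.
  have [_ + _] := (continuous_within_itvP f ltr01).1 cf.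
  rewrite f0 => /cvgr_lt/(_ rho rho0)[d /= d0 dP].
  exists (Num.min (d / 2) 1); first by rewrite lt_min divr_gt0 //= ge_min lexx orbT.
  move=> t t0; rewrite le_min => /andP[td _].
  have [<-|tn0] := eqVneq 0 t; first by rewrite f0.
  apply: dP; last by rewrite lt_neqAle tn0.
  by rewrite /= sub0r normrN ger0_norm //; lra.
have sub (x : R) : 0 <= x -> `[x, 1] `<=` `[0, 1].
  by move=> x0 y /=; rewrite !in_itv /= => /andP[xy ->]; rewrite (le_trans x0).
have [c] := EVT_min tau1 (continuous_subspaceW (sub _ (ltW tau0)) cf).
rewrite in_itv /= => /andP[tc c1] cmin.
have fc0 : 0 < f c.
  rewrite normr_gt0 subr_eq0; apply/eqP; apply: alphaN => //.
  exact: lt_le_trans tc.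
exists (f c / 2); first by rewrite divr_gt0.
move=> r r0 rc; have rfc : r < f c by lra.
have late t : tau <= t -> t <= 1 -> r < f t.
  move=> t1 t2; apply: lt_le_trans rfc _; apply: cmin.
  by rewrite in_itv /= t1.
pose A := [set t | 0 <= t <= 1 /\ f t <= r].
have A0 : A 0 by rewrite /A /= f0 lexx ler01 ltW.
have ubA : has_sup A.
  by split; [exists 0 | exists 1 => t [/andP[]]].
pose s := sup A.
have As t : A t -> t <= s by move=> At; exact: sup_upper_bound ubA _ At.
have s0 : 0 <= s by exact: As.
have s1 : s <= 1 by apply: sup_le_ub; [exists 0 | move=> t [/andP[]]].
have after t : s < t -> t <= 1 -> r < f t.
  move=> st t1; rewrite ltNge; apply/negP => ft.
  have : A t by split => //; rewrite t1 (ltW (le_lt_trans s0 st)).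
  by move=> /As; rewrite leNgt st.
(* By continuity, [r < f s] would persist near [s], where [A] has points. *)
have fs : f s <= r.
  rewrite leNgt; apply/negP => rfs.
  have s01 : `[0, 1]%classic s by rewrite /= in_itv /= s0.
  have : \forall t \near within `[0, 1] (nbhs s), r < f t.
    have /subspace_continuousP/(_ s s01) := cf.
    by move=> /cvgr_gt; apply.
  move=> /nbhs_ballP[d /= d0 dP].
  have [t At st] := sup_adherent d0 ubA.
  case: (At) => t01 ft; suff : r < f t by rewrite ltNge ft.
  apply: dP; last by rewrite /= in_itv.
  rewrite -ball_normE /= ger0_norm; last by rewrite subr_ge0; apply: As.
  by rewrite /s in st *; lra.
have f1 : r < f 1 by apply: late.
(* Any such [x] belongs to [A], hence is at most [s], and so equals [s]. *)
have [x] : exists2 x, x \in `[s, 1] & f x = r.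
  apply: IVT => //; first exact: continuous_subspaceW (sub _ s0) cf.
  by rewrite min_l ?max_r ?fs ?ltW // (le_lt_trans fs f1).
rewrite in_itv /= => /andP[sx x1] fx.
have xs : x = s.
  by apply/eqP; rewrite eq_le sx andbT; apply: As; split; rewrite ?fx // x1 (le_trans s0 sx).
rewrite xs in fx.
exists s; split=> //.
  split=> //; rewrite lt_neqAle s0 andbT; apply/eqP => s0'.
  by move: fx; rewrite -s0' f0 => r0'; rewrite -r0' ltxx in r0.
move=> t t0 ts; rewrite -ball_normE /= -opprB normrN; apply: tauP => //.
apply: le_trans ts _; rewrite leNgt; apply/negP => /ltW/late/(_ s1).
by rewrite fx ltxx.
Qed.

Section Drawing.
Variables (R : realType) (G : sgraph) (d : plane_drawing R G).
Implicit Types (u v w : G) (e f : {set G}) (t : R).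

Lemma edge_mem u v : adj u v -> [set u; v]%SET \in edges G.
Proof.
move=> uv; rewrite inE; apply/existsP; exists u; apply/existsP; exists v.
by rewrite uv eqxx.
Qed.

Lemma arc_end e t : e \in edges G -> t = 0 \/ t = 1 ->
  exists2 v, v \in e & Defs.arc d e t = pos d v.
Proof.
move=> eG t01.
have : [set Defs.arc d e 0; Defs.arc d e 1] (Defs.arc d e t) by case: t01 => ->; [left | right].
by rewrite (arc_ends d eG) => -[v /= ve <-]; exists v.
Qed.

Lemma itv01_cases t : 0 <= t <= 1 -> [\/ t = 0, t = 1 | t \in `]0, 1[ ].
Proof.
move=> /andP[t0 t1]; have [<-|n0] := eqVneq 0 t; first by constructor 1.
have [->|n1] := eqVneq t 1; first by constructor 2.
by constructor 3; rewrite in_itv /= !lt_neqAle n0 n1 t0.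
Qed.

Lemma vertex_on_arc e v t : e \in edges G -> 0 <= t <= 1 ->
  Defs.arc d e t = pos d v -> v \in e.
Proof.
move=> eG /itv01_cases t01 ev.
have t01' : t = 0 \/ t = 1.
  by case: t01 => [|| t01]; [left | right | case: (arc_avoids_vertices eG t01 ev)].
have [w we] := arc_end eG t01'.
by rewrite ev => /(@pos_inj _ _ d) ->.
Qed.

Lemma arcs_meet e f s t : e \in edges G -> f \in edges G -> e <> f ->
  0 <= s <= 1 -> 0 <= t <= 1 -> Defs.arc d e s = Defs.arc d f t ->
  exists v, [/\ v \in e, v \in f & Defs.arc d e s = pos d v].
Proof.
move=> eG fG ef s01 t01 est.
have fin v : Defs.arc d e s = pos d v ->
    exists v, [/\ v \in e, v \in f & Defs.arc d e s = pos d v].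
  move=> ev; exists v; split=> //; first exact: vertex_on_arc ev.
  by apply: (@vertex_on_arc f v t) => //; rewrite -est.
case: (itv01_cases s01) => [s0|s1|si].
- by have [v _ /fin] := arc_end eG (or_introl s0).
- by have [v _ /fin] := arc_end eG (or_intror s1).
case: (itv01_cases t01) => [t0|t1|ti].
- by have [v _] := arc_end fG (or_introl t0); rewrite -est => /fin.
- by have [v _] := arc_end fG (or_intror t1); rewrite -est => /fin.
by case: (arcs_disjoint eG fG ef si ti est).
Qed.

(** A drawing fixes the ends of an arc only as a set, so the arc may have to be reversed by
    [1 - t]. *)
Lemma arc_from u v : adj u v -> exists alpha : R -> R * R,
  [/\ {within `[0, 1], continuous alpha}, alpha 0 = pos d u, alpha 1 = pos d v,
      forall t, 0 < t -> t <= 1 -> alpha t <> pos d u &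
      forall t, 0 <= t <= 1 -> exists2 s, 0 <= s <= 1 & alpha t = Defs.arc d [set u; v]%SET s].
Proof.
move=> uv; have eG := edge_mem uv; set e := [set u; v]%SET in eG *.
have nuv : u <> v by move=> E; move: uv; rewrite E adj_irrefl.
have in01 t : 0 <= t <= 1 -> t \in `[0, 1] by rewrite in_itv.
have inj (s t : R) : 0 <= s <= 1 -> 0 <= t <= 1 -> Defs.arc d e s = Defs.arc d e t -> s = t.
  by move=> s01 t01; apply: (arc_inj eG); apply: in01.
have i0 : 0 <= (0 : R) <= 1 by rewrite lexx ler01.
have i1 : 0 <= (1 : R) <= 1 by rewrite lexx ler01.
have [x xe e0] := arc_end eG (or_introl (erefl 0)).
have [y ye e1] := arc_end eG (or_intror (erefl 1)).
have nxy : x <> y.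
  by move=> E; have := inj _ _ i0 i1; rewrite e0 e1 E => /(_ erefl)/eqP; rewrite eq_sym oner_eq0.
have [[xu yv]|[xv yu]] : (x = u /\ y = v) \/ (x = v /\ y = u).
  by move: xe ye nxy; rewrite !inE => /orP[] /eqP -> /orP[] /eqP ->; by [left | right | case].
- exists (Defs.arc d e); split; rewrite ?e0 ?e1 ?xu ?yv //; first exact: arc_continuous.
    move=> t t0 t1; rewrite -xu -e0 => /inj E.
    have t00 : t = 0 by apply: E; lra.
    by rewrite t00 ltxx in t0.
  by move=> t t01; exists t.
- exists (fun t => Defs.arc d e (1 - t)); split; rewrite ?subr0 ?subrr ?e0 ?e1 ?xv ?yu //.
  + apply/subspace_continuousP => t t01 /=.
    have t01' : `[0, 1]%classic (1 - t) by move: t01; rewrite /= !in_itv /=; lra.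
    have /subspace_continuousP/(_ _ t01') := @arc_continuous _ _ d _ eG.
    move=> H P /H /nbhs_ballP[q /= q0 qP]; apply/nbhs_ballP; exists q => //= z zt z01.
    apply: qP; last by move: z01; rewrite /= !in_itv /=; lra.
    by move: zt; rewrite -!ball_normE /= ; rewrite !ltr_norml; lra.
  + move=> t t0 t1; rewrite -yu -e1 => /inj E; have : 1 - t = 1 by apply: E; lra.
    by lra.
  + by move=> t t01; exists (1 - t) => //; lra.
Qed.

Lemma arc_compact e : e \in edges G -> compact (Defs.arc d e @` `[0, 1]).
Proof.
by move=> eG; apply: continuous_compact; [exact: arc_continuous | exact: segment_compact].
Qed.

Lemma path_set (Y : {set G}) u v : u \notin Y -> joined_outside Y u v ->
  exists K : set (R * R),
  [/\ closed K, connected K, K (pos d u), K (pos d v) & forall z, K z ->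
    (exists2 w, w \notin Y & z = pos d w) \/
    (exists e t, [/\ e \in edges G, {in e, forall x, x \notin Y},
       0 <= t <= 1 & z = Defs.arc d e t])].
Proof.
move=> uY /connectP[p pp ->] {v}.
elim: p u uY pp => [|w p IH] u uY /=.
  move=> _; exists [set pos d u]; split=> //.
  - by apply: compact_closed; [exact: norm_hausdorff | exact: compact_set1].
  - exact: connected1.
  - by move=> z ->; left; exists u.
move=> /andP[/and3P[_ wY uw] /(IH _ wY)[K [cK coK Kw Kl KP]]].
have eG := edge_mem uw; set e := [set u; w]%SET in eG *.
have endpt x : x \in e -> (Defs.arc d e @` `[0, 1]) (pos d x).
  move=> xe; have : [set pos d v | v in [set` e]] (pos d x) by exists x.
  by rewrite -(arc_ends d eG) => -[] ->; [exists 0 | exists 1] => //=; rewrite in_itv /= lexx ler01.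
exists (Defs.arc d e @` `[0, 1] `|` K); split.
- by apply: closedU => //; apply: compact_closed; [exact: norm_hausdorff | exact: arc_compact].
- apply: connectedU => //.
    by exists (pos d w); split => //; apply: endpt; rewrite !inE eqxx orbT.
  by apply: connected_continuous_connected; [exact: segment_connected | exact: arc_continuous].
- by left; apply: endpt; rewrite !inE eqxx.
- by right.
- move=> z [[t /= t01 <-]|/KP //]; right; exists e, t; split=> //.
  by move=> x; rewrite !inE => /orP[] /eqP ->.
Qed.

Variable F : set (R * R).
Hypotheses (Fconn : connected F) (Foff : F `<=` ~` drawing_set d)
  (Fvertices : forall v, closure F (pos d v)).

(** The arc from [a] to [u] is split at its last visit, and the rest of the route is drawn along a
    path avoiding [Y], hence at a positive distance from [a]. Every small [r] is allowed because
    three legs must share one square. *)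
Lemma leg_exists a b u (Y : {set G}) (rho : R) : adj a u -> a \in Y -> u \notin Y ->
  joined_outside Y u b -> 0 < rho -> rho <= `|pos d u - pos d a| ->
  exists2 r0 : R, 0 < r0 & forall r : R, 0 < r -> r <= r0 -> exists q I X K,
    [/\ leg (pos d a) (pos d b) r rho F (pos d u) q I X K,
     forall z, X z -> z <> pos d a /\
       exists2 t, 0 <= t <= 1 & z = Defs.arc d [set a; u]%SET t &
     forall z, K z -> (exists2 w, w \notin Y & z = pos d w) \/
       (exists e t, [/\ e \in edges G, {in e, forall x, x \notin Y},
          0 <= t <= 1 & z = Defs.arc d e t])].
Proof.
move=> au aY uY /(path_set uY)[K [clK coK Ku Kb KP]] rho0 rhou.
have [alpha [calpha a0 a1 aN aarc]] := arc_from au.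
have [r1 r10 r1P] := last_visit calpha a0 aN rho0.
have nKa : ~ K (pos d a).
  move=> /KP[[w wY /(@pos_inj _ _ d) E]|[e [t [eG eY t01 /esym/(vertex_on_arc eG t01)/eY]]]].
    by rewrite -E aY in wY.
  by rewrite aY.
have [r2 r20 r2P] : exists2 r2, 0 < r2 & forall z, K z -> r2 <= `|z - pos d a|.
  have : nbhs (pos d a) (~` K) by apply: open_nbhs_nbhs; split; [exact: closed_openC|].
  move=> /nbhs_ballP[q /= q0 qP]; exists q => // z Kz.
  rewrite leNgt; apply/negP => zq; apply: (qP z) => //.
  by rewrite -ball_normE /= -opprB normrN.
(* Halving [r2] makes the inequality in [leg_Kout] strict. *)
exists (Num.min r1 (r2 / 2)); first by rewrite lt_min r10 divr_gt0.
move=> r r0; rewrite le_min => /andP[/(r1P _ r0)[s [[s0 s1] ns after before]] rr2].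
have sub1 : `[0, s] `<=` `[0, 1].
  by move=> t /=; rewrite !in_itv /= => /andP[-> ts]; rewrite (le_trans ts).
have sub2 : `[s, 1] `<=` `[0, 1].
  by move=> t /=; rewrite !in_itv /= => /andP[st ->]; rewrite (le_trans (ltW s0)).
have img t : 0 <= t <= 1 -> drawing_set d (alpha t).
  move=> /aarc[t' t01 ->]; right; exists [set a; u]%SET; first exact: edge_mem.
  by exists t' => //=; rewrite in_itv.
exists (alpha s), (alpha @` `[0, s]), (alpha @` `[s, 1]), K; split=> //.
- split=> //.
  + apply: compact_closed; first exact: norm_hausdorff.
    by apply: continuous_compact; [exact: continuous_subspaceW sub1 _ | exact: segment_compact].
  + apply: connected_continuous_connected; first exact: segment_connected.
    exact: continuous_subspaceW sub1 _.
  + by exists 0 => //=; rewrite in_itv /= lexx ltW.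
  + by exists s => //=; rewrite in_itv /= lexx ltW.
  + by move=> z [t /=]; rewrite in_itv /= => /andP[t0 ts] <-; exact: before.
  + apply: compact_closed; first exact: norm_hausdorff.
    by apply: continuous_compact; [exact: continuous_subspaceW sub2 _ | exact: segment_compact].
  + apply: connected_continuous_connected; first exact: segment_connected.
    exact: continuous_subspaceW sub2 _.
  + by exists s => //=; rewrite in_itv /= lexx.
  + by exists 1 => //=; rewrite in_itv /= lexx s1.
  + move=> z [t /=]; rewrite in_itv /= => /andP[st t1] <- ns'.
    apply: after => //; rewrite lt_neqAle st andbT; apply/eqP => E.
    by apply: ns'; rewrite E.
  + by move=> z /r2P; apply: lt_le_trans; lra.
  + move=> z /Foff nz [[|]|].
    * move=> [t /=]; rewrite in_itv /= => /andP[t0 ts] E; apply: nz; rewrite -E.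
      by apply: img; rewrite t0 (le_trans ts).
    * move=> [t /=]; rewrite in_itv /= => /andP[st t1] E; apply: nz; rewrite -E.
      by apply: img; rewrite t1 (le_trans (ltW s0)).
    * move=> /KP[[w _ E]|[e [t [eG _ t01 E]]]]; apply: nz; rewrite E; first by left; exists w.
      by right; exists e => //; exists t => //=; rewrite in_itv.
  + by rewrite -ball_normE /= -opprB normrN => /lt_le_trans/(_ rhou); rewrite ltxx.
- move=> z [t /=]; rewrite in_itv /= => /andP[st t1] <-; split.
    by apply: aN => //; apply: lt_le_trans st.
  by apply: aarc; rewrite t1 (le_trans (ltW s0)).
Qed.

(** Arcs of different edges meet only at common vertices. The edges to [ul] and [uj] share only [a],
    which [Xl] omits, and both ends of the edge to [ul] belong to [Yj], which [Kj] avoids. *)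
Lemma legs_apart a ul uj (Yj : {set G}) (Xl Xj Kj : set (R * R)) :
  adj a ul -> adj a uj -> ul != uj -> a \in Yj -> ul \in Yj ->
  (forall z, Xl z -> z <> pos d a /\
     exists2 t, 0 <= t <= 1 & z = Defs.arc d [set a; ul]%SET t) ->
  (forall z, Xj z -> z <> pos d a /\
     exists2 t, 0 <= t <= 1 & z = Defs.arc d [set a; uj]%SET t) ->
  (forall z, Kj z -> (exists2 w, w \notin Yj & z = pos d w) \/
     (exists e t, [/\ e \in edges G, {in e, forall x, x \notin Yj},
        0 <= t <= 1 & z = Defs.arc d e t])) ->
  forall z, Xl z -> ~ (Xj `|` Kj) z.
Proof.
move=> al aj lj aY lY Pl Pj PK z /Pl[za [t t01 zt]] [/Pj[_ [s s01 zs]]|/PK].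
  have ne : [set a; ul]%SET <> [set a; uj]%SET.
    move=> E; have : ul \in [set a; uj]%SET by rewrite -E !inE eqxx orbT.
    rewrite !inE (negbTE lj) orbF => /eqP E'.
    by move: al; rewrite E' adj_irrefl.
  have := arcs_meet (edge_mem al) (edge_mem aj) ne t01 s01; rewrite -zt -zs.
  move=> /(_ erefl)[v []]; rewrite !inE => /orP[/eqP -> //|/eqP ->].
  by rewrite (negbTE lj) orbF => /eqP ->.
have edgeY x : x \in [set a; ul]%SET -> x \in Yj.
  by rewrite !inE => /orP[] /eqP ->.
case=> [[w wY zw]|[e [s [eG eY s01 zs]]]].
  have := vertex_on_arc (edge_mem al) t01; rewrite -zt => /(_ _ zw)/edgeY.
  by rewrite (negbTE wY).
have ne : [set a; ul]%SET <> e.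
  by move=> E; have := eY a; rewrite -E !inE eqxx aY => /(_ isT).
have := arcs_meet (edge_mem al) eG ne t01 s01; rewrite -zt -zs.
by move=> /(_ erefl)[v [/edgeY vY /eY]]; rewrite vY.
Qed.

Lemma drawing_no_theta (p0 : R * R) a b u1 u2 u3 : F p0 ->
  adj a u1 -> adj a u2 -> adj a u3 -> uniq [:: u1; u2; u3] ->
  joined_outside [set a; u2; u3]%SET u1 b -> joined_outside [set a; u1; u3]%SET u2 b ->
  joined_outside [set a; u1; u2]%SET u3 b -> False.
Proof.
move=> Fp0 a1 a2 a3 /=; rewrite !inE negb_or andbT => /andP[/andP[n12 n13] n23] j1 j2 j3.
have nadj v : adj a v -> v != a by apply: contraTneq => ->; rewrite adj_irrefl.
have dpos v : adj a v -> 0 < `|pos d v - pos d a|.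
  move=> av; rewrite normr_gt0 subr_eq0; apply/eqP => /(@pos_inj _ _ d) E.
  by have := nadj v av; rewrite E eqxx.
(* With this choice none of the three neighbours is drawn in the open square of radius [rho] around
   [a]. *)
pose rho := Num.min `|pos d u1 - pos d a|
  (Num.min `|pos d u2 - pos d a| `|pos d u3 - pos d a|).
have rho0 : 0 < rho by rewrite !lt_min !dpos.
have [|||||r1 r10 r1P] := @leg_exists a b u1 [set a; u2; u3]%SET rho a1 => //;
  rewrite ?inE ?eqxx ?negb_or ?nadj ?n12 ?n13 ?ge_min ?lexx ?orbT //.
have [|||||r2 r20 r2P] := @leg_exists a b u2 [set a; u1; u3]%SET rho a2 => //;
  rewrite ?inE ?eqxx ?negb_or ?nadj ?(eq_sym u2) ?n12 1?eq_sym ?n23 ?ge_min ?lexx ?orbT //.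
have [|||||r3 r30 r3P] := @leg_exists a b u3 [set a; u1; u2]%SET rho a3 => //;
  rewrite ?inE ?eqxx ?negb_or ?nadj ?(eq_sym u3) ?n13 ?n23 ?ge_min ?lexx ?orbT //.
pose r := Num.min (rho / 2) (Num.min r1 (Num.min r2 r3)).
have r0 : 0 < r by rewrite !lt_min divr_gt0 //= r10 r20.
have rrho : r < rho by have : r <= rho / 2 by [rewrite ge_min lexx]; lra.
have [e1 [I1 [X1 [K1 [l1 X1P K1P]]]]] := r1P r r0 ltac:(by rewrite !ge_min lexx !orbT).
have [e2 [I2 [X2 [K2 [l2 X2P K2P]]]]] := r2P r r0 ltac:(by rewrite !ge_min lexx !orbT).
have [e3 [I3 [X3 [K3 [l3 X3P K3P]]]]] := r3P r r0 ltac:(by rewrite !ge_min lexx !orbT).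
apply: (no_three_legs r0 rrho Fconn Fp0 l1 l2 l3).
- by apply: (@legs_apart a u1 u2 [set a; u1; u3]%SET); rewrite // !inE eqxx ?orbT.
- by apply: (@legs_apart a u1 u3 [set a; u1; u2]%SET); rewrite // !inE eqxx ?orbT.
- by apply: (@legs_apart a u2 u1 [set a; u2; u3]%SET); rewrite // 1?eq_sym // !inE eqxx ?orbT.
- by apply: (@legs_apart a u2 u3 [set a; u1; u2]%SET); rewrite // !inE eqxx ?orbT.
- by apply: (@legs_apart a u3 u1 [set a; u2; u3]%SET); rewrite // 1?eq_sym // !inE eqxx ?orbT.
- by apply: (@legs_apart a u3 u2 [set a; u1; u3]%SET); rewrite // 1?eq_sym // !inE eqxx ?orbT.
Qed.
End Drawing.

Lemma outerplanar_no_theta (R : realType) (G : sgraph) (a b u1 u2 u3 : G) :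
  outerplanar R G -> adj a u1 -> adj a u2 -> adj a u3 -> uniq [:: u1; u2; u3] ->
  joined_outside [set a; u2; u3]%SET u1 b -> joined_outside [set a; u1; u3]%SET u2 b ->
  joined_outside [set a; u1; u2]%SET u3 b -> False.
Proof.
move=> [d [F [[p np FE] _ Fv]]].
apply: (@drawing_no_theta _ _ d F _ _ Fv p); rewrite FE.
- exact: component_connected.
- exact: connected_component_sub.
- exact: connected_component_refl.
Qed.

End PlaneTopology.

Theorem theorem18 (R : realType) (G : sgraph) (Delta g : nat)
    (h2conn : k_connected 2 G) (houter : outerplanar R G)
    (hDelta : max_degree G = Delta) (hDelta4 : (4 <= Delta)%N)
    (hgirth : is_girth G g) (hgirth4 : (4 <= g)%N) :
  exists2 k : nat, is_chi_vi G 1 k & (k <= Delta + 3)%N.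
Proof.
have tf : theta_free G by move=> a b u1 u2 u3; exact: outerplanar_no_theta houter.
have tri : triangle_free G.
  move=> a b u ab bu au; have [_ /(_ 3)] := hgirth.
  suff c3 : graph_cycle [:: a; b; u] by move=> /(_ (ex_intro2 _ _ _ c3 erefl)); lia.
  have neq (x y : G) : adj x y -> x != y.
    by apply: contraTneq => ->; rewrite adj_irrefl.
  split=> //; apply/andP; split; first by rewrite /= ab bu adj_sym au.
  by rewrite /= !inE negb_or !neq.
have [s [s2 us] sT] : exists2 s : seq G, graph_cycle s & forall v, v \in s.
  by apply: hamiltonian_cycle => //; have [[s cs _] _] := hgirth; exists s.
have nc := noncrossing_cycle tf tri us.
have [cyc uniqs] := andP us.
have [x sx] : exists x, x \in s by case: (s) s2 => // x l _; exists x; exact: mem_head.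
have degD (v : G) : #|neighbours v| <= Delta.
  rewrite -hDelta. exact: (@leq_bigmax G (fun w : G => #|neighbours w|) v).
have [ssort hl] : sorted (@adj G) s /\ adj (head x s) (last x s).
  case: (s) s2 cyc => //= y l _; rewrite rcons_path => /andP[-> h].
  by rewrite adj_sym.
have [c [d cd]] := outer_cycle_colouring (erefl (Delta + 3)) hDelta4 degD tri uniqs
  (ltnW s2) ssort hl nc.
have sE : [set v in s]%SET = [set: G]%SET by apply/setP => v; rewrite !inE sT.
rewrite sE in cd; have [f fP] := vi_pair_coloring cd.
(* The least number of colours exists by well-ordering, and the colouring [f] bounds it. *)
pose P k := `[< exists f : G + incidence G -> 'I_k, ks_coloring 1 f >].
have exP : exists k, P k by exists (Delta + 3); apply/asboolP; exists f.
case: (ex_minnP exP) => k /asboolP kP kmin; exists k.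
  by split=> // m mP; apply: kmin; exact/asboolP.
by apply: kmin; apply/asboolP; exists f.
Qed.
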